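(* For every $\delta>0$ there is $c=c(\delta)>0$ such that the following holds. Let $G$ be a compact vector space over $\mathbb{F}_2$, let $M\ge 16$, and let $A\subset G$ be a measurable set of density $\alpha$ such that for every finite subgroup $V\le\widehat G$ with $|V|\le M$, \[ \{\alpha|V|\}\bigl(1-\{\alpha|V|\}\bigr)\ \ge\ \delta . \] Then $\|\chi_A\|_{A(G)}\ge c\log\log M$.
   Context: A compact vector space over $\mathbb{F}_2$ is a compact Hausdorff abelian group $G$ with $x+x=0$ for all $x$; its dual $\widehat G$ (continuous homomorphisms $G\to S^1$, written additively) is a discrete $\mathbb{F}_2$-vector space. $\mu_G$ is Haar probability measure; the density of $A$ is $\mu_G(A)$. $\widehat f(\gamma)=\int_G f\overline{\gamma}\,d\mu_G$, and $\|f\|_{A(G)}=\sum_{\gamma\in\widehat G}|\widehat f(\gamma)|$ (possibly $+\infty$). $\{t\}$ denotes the fractional part of a real number $t$. *)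

(* Defs.v *)
(* MathComp-Analysis (topology, measure theory, Lebesgue integration). *)
From HB Require Import structures.
From mathcomp Require Import all_boot all_order all_algebra.
From mathcomp Require Import all_classical all_reals all_analysis.
From mathcomp Require Import complex.
Import Order.TTheory GRing.Theory Num.Theory ComplexField.
Import numFieldNormedType.Exports numFieldTopology.Exports.

Set Implicit Arguments.
Unset Strict Implicit.
Unset Printing Implicit Defensive.

Local Open Scope ring_scope.
Local Open Scope classical_set_scope.

(* Borel sigma-algebra on a topological abelian group G *)
(* Copy of G with a (irrelevant) distinguished point 0, needed by the
   generated-sigma-algebra construction of MathComp-Analysis. *)
Definition Gp (G : topologicalZmodType) : Type := G.
HB.instance Definition _ (G : topologicalZmodType) := Topological.on (Gp G).
HB.instance Definition _ (G : topologicalZmodType) := GRing.Zmodule.on (Gp G).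
HB.instance Definition _ (G : topologicalZmodType) := isPointed.Build (Gp G) 0.
Notation borel G := (g_sigma_algebraType (@open (Gp G))).


(* G is a compact vector space over F_2: a compact Hausdorff topological
   abelian group in which x + x = 0 for every x. *)
Definition compact_F2_space (G : topologicalZmodType) : Prop :=
  [/\ compact [set: G], hausdorff_space G & forall x : G, x + x = 0].

(* mu is the Haar probability measure of G: a Radon (inner regular by compact
   sets) translation-invariant Borel probability measure. *)
Definition haar_probability (R : realType) (G : topologicalZmodType)
    (mu : {measure set (borel G) -> \bar R}) : Prop :=
  [/\ mu setT = 1%E,
      (forall (x : G) (B : set (borel G)), measurable B ->
         mu [set x + y | y in B] = mu B) &
      (forall B : set (borel G), measurable B ->
         mu B = ereal_sup [set mu K | K in [set K : set G | compact K /\ K `<=` B]])].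

(* Characters: continuous homomorphisms G -> S^1 (unit circle of C = R[i]),
   with G written additively and S^1 multiplicatively. *)
Definition character (R : realType) (G : topologicalZmodType) (g : G -> (R[i])^o) : Prop :=
  [/\ continuous g,
      (forall x, `|g x| = 1) &
      (forall x y, g (x + y) = g x * g y)].

(* The dual group \hat G as a set of functions. *)
Definition dual (R : realType) (G : topologicalZmodType) : set (G -> R[i]) :=
  [set g | character g].

(* Complex-valued integral, defined through real and imaginary parts. *)
Definition cintegral (R : realType) (G : topologicalZmodType)
    (mu : {measure set (borel G) -> \bar R}) (f : G -> R[i]) : R[i] :=
  ((Rintegral mu setT (fun x => complex.Re (f x)))%:C
  + 'i * (Rintegral mu setT (fun x => complex.Im (f x)))%:C)%C.

(* Fourier coefficient  \hat f(gamma) = \int_G f \bar gamma d mu. *)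
Definition fourier (R : realType) (G : topologicalZmodType)
    (mu : {measure set (borel G) -> \bar R}) (f : G -> R[i]) (g : G -> R[i]) : R[i] :=
  cintegral mu (fun x => f x * (g x)^*).

(* Indicator function chi_A, complex valued. *)
Definition cindic (R : realType) (G : topologicalZmodType) (A : set G) : G -> R[i] :=
  fun x => ((\1_A x : R)%:C)%C.

(* Wiener algebra norm  ||f||_{A(G)} = sum_{gamma in \hat G} |\hat f(gamma)|, in \bar R. *)
Definition Anorm (R : realType) (G : topologicalZmodType)
    (mu : {measure set (borel G) -> \bar R}) (f : G -> R[i]) : \bar R :=
  esum (@dual R G) (fun g => (ComplexField.Normc.normc (fourier mu f g))%:E).

(* V is a finite subgroup of \hat G (group law: pointwise product). *)
Definition finite_subgroup_dual (R : realType) (G : topologicalZmodType)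
    (V : set (G -> R[i])) : Prop :=
  [/\ finite_set V, V `<=` @dual R G,
      V (fun _ => 1),
      (forall g h, V g -> V h -> V (fun x => g x * h x)) &
      (forall g, V g -> V (fun x => (g x)^-1))].

(* Fractional part {t} = t - floor t. *)
Definition fracpart (R : realType) (t : R) : R := t - (Num.floor t)%:~R.

(* Cardinality of a finite set of characters (a natural number). *)
Definition card_set (R : realType) (G : topologicalZmodType) (V : set (G -> R[i])) : nat :=
  size (finmap.enum_fset (fset_set V)).

(* Main.v *)
(** For a finite subgroup V of the dual let f_V be the conditional expectation of
    chi_A on the cosets of the annihilator of V. Subadditivity of
    t |-> {t}(1 - {t}) turns the hypothesis into eta := E f_V (1 - f_V) >= delta / |V|,
    which is the l2-mass of the Fourier transform of chi_A outside V, while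
    chi_A - f_V has L1-norm at most 2 eta. A dyadic decomposition gives i >= 1 for
    which the frequencies outside V with coefficient above 2^-i (2 eta) carry
    l1-mass at least i / 16; by Chang's inequality they span at most
    O(4^i log (1 / eta)) new dimensions. Adding them to V multiplies the dimension
    by O(1)^i for a gain of i / 16, and iterating until |V| > M yields log log M.

    All this takes place in a quotient F_2^n of G on which A is nearly a union of
    fibres. Such quotients exist because every neighbourhood U of 0 contains an open
    subgroup: Bogolyubov's theorem in the finite subgroups F of G gives subgroups of
    F of bounded index inside 4C, for a small neighbourhood C of 0, and the closure
    of their limit along an ultrafilter has finite index and lies in U. *)
Require Import Defs.
From HB Require Import structures.
From mathcomp Require Import all_boot all_order all_algebra finfield.
From mathcomp Require Import all_classical all_reals all_analysis.
From mathcomp Require Import complex measurable_realfun ring lra.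
Import Order.TTheory GRing.Theory Num.Theory ComplexField.
Import numFieldNormedType.Exports numFieldTopology.Exports.
Local Open Scope ring_scope.
Local Open Scope classical_set_scope.

Set Implicit Arguments.
Unset Strict Implicit.
Unset Printing Implicit Defensive.

(** * Means on finite sets *)

Section Mean.
Variables (R : realFieldType) (T : finType).
Implicit Types f g : T -> R.

Definition mean f : R := #|T|%:R^-1 * \sum_x f x.

Lemma eq_mean f g : f =1 g -> mean f = mean g.
Proof. by move=> fg; congr (_ * _); apply: eq_bigr. Qed.

Lemma meanD f g : mean (fun x => f x + g x) = mean f + mean g.
Proof. by rewrite /mean big_split /= mulrDr. Qed.

Lemma meanB f g : mean (fun x => f x - g x) = mean f - mean g.
Proof. by rewrite /mean sumrB mulrBr. Qed.

Lemma meanZ a f : mean (fun x => a * f x) = a * mean f.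
Proof. by rewrite /mean -big_distrr /= mulrCA. Qed.

Lemma mean_sum (I : Type) (r : seq I) (P : pred I) (F : I -> T -> R) :
  mean (fun x => \sum_(i <- r | P i) F i x) = \sum_(i <- r | P i) mean (F i).
Proof. by rewrite /mean exchange_big /= big_distrr. Qed.

Lemma ler_mean f g : (forall x, f x <= g x) -> mean f <= mean g.
Proof. by move=> fg; rewrite ler_wpM2l ?invr_ge0 //; exact: ler_sum. Qed.

Lemma ler_norm_mean f : `|mean f| <= mean (fun x => `|f x|).
Proof.
by rewrite /mean normrM ger0_norm ?invr_ge0 // ler_wpM2l ?invr_ge0 // ler_norm_sum.
Qed.

Lemma mean_neq0 f : mean f != 0 -> exists x, f x != 0.
Proof.
move=> f_neq0; apply/existsP; apply: contraNT f_neq0 => /existsPn f0.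
by rewrite /mean big1 ?mulr0 // => x _; apply/eqP; have := f0 x; rewrite negbK.
Qed.

Hypothesis T_gt0 : (0 < #|T|)%N.

Lemma mean_cst a : mean (fun=> a) = a.
Proof.
by rewrite /mean sumr_const -[a *+ _]mulr_natl mulKf // pnatr_eq0 -lt0n.
Qed.

Lemma mean_itv f : (forall x, 0 <= f x <= 1) -> 0 <= mean f <= 1.
Proof.
move=> f01; apply/andP; split.
  by rewrite -[leLHS]mean_cst; apply: ler_mean => x; case/andP: (f01 x).
by rewrite -[leRHS]mean_cst; apply: ler_mean => x; case/andP: (f01 x).
Qed.

Definition bernoulli_var f : R := mean (fun x => f x * (1 - f x)).

Lemma bernoulli_varE f : bernoulli_var f = mean f - mean (fun x => f x * f x).
Proof. by rewrite -meanB; apply: eq_mean => x; ring. Qed.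

Lemma bernoulli_var_le f : bernoulli_var f <= 1 / 4.
Proof.
rewrite -[leRHS]mean_cst; apply: ler_mean => x.
by have := sqr_ge0 (f x - 1 / 2); lra.
Qed.

End Mean.

Lemma exchange_mean (R : realFieldType) (T U : finType) (F : T -> U -> R) :
  mean (fun x => mean (F x)) = mean (fun y => mean (F ^~ y)).
Proof. by rewrite /mean -!big_distrr /= exchange_big mulrCA. Qed.

(** * Fourier analysis on F_2^n *)

Section ExponentTwo.
Variable G : zmodType.
Hypothesis G2 : forall x : G, x + x = 0.
Implicit Types x y z : G.

Lemma oppr_exp2 x : - x = x.
Proof. by apply/eqP; rewrite eq_sym -addr_eq0 G2. Qed.

Lemma subr_exp2 x y : x - y = x + y.
Proof. by rewrite oppr_exp2. Qed.

Lemma addKr_exp2 x y : x + (x + y) = y.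
Proof. by rewrite addrA G2 add0r. Qed.

Lemma addrK_exp2 x y : y + x + x = y.
Proof. by rewrite -addrA G2 addr0. Qed.

Lemma addrKA_exp2 x y z : x + y + (y + z) = x + z.
Proof. by rewrite addrA addrK_exp2. Qed.

End ExponentTwo.

Section DotProduct.
Variable n : nat.
Local Notation T := 'rV['F_2]_n.
Implicit Types (w x y : T) (S : {pred T}).

Lemma addxx_F2 x : x + x = 0.
Proof. by apply/rowP => i; rewrite !mxE addrr_pchar2 // pchar_Fp. Qed.

Lemma card_F2_gt0 : (0 < #|{: T}|)%N.
Proof. by apply/card_gt0P; exists 0. Qed.

Definition dot w x : 'F_2 := (w *m x^T) 0 0.

Lemma dotC w x : dot w x = dot x w.
Proof. by rewrite /dot -[w *m x^T]trmxK trmx_mul trmxK mxE. Qed.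

Lemma dotDr w x y : dot w (x + y) = dot w x + dot w y.
Proof. by rewrite /dot linearD /= mulmxDr mxE. Qed.

Lemma dot0r w : dot w 0 = 0.
Proof. by rewrite /dot trmx0 mulmx0 mxE. Qed.

Lemma dot_nondegenerate x : x != 0 -> exists w, dot w x != 0.
Proof.
by case/rV0Pn => i xi; exists (delta_mx 0 i); rewrite /dot -rowE !mxE.
Qed.

Definition perp S : {set T} := [set x | [forall w in S, dot w x == 0]].

Lemma perpP S x : reflect {in S, forall w, dot w x = 0} (x \in perp S).
Proof. by rewrite inE; apply: (iffP 'forall_in_eqP). Qed.

Lemma perpD S x y : x \in perp S -> y \in perp S -> x + y \in perp S.
Proof.
by move=> /perpP xS /perpP yS; apply/perpP => w wS; rewrite dotDr xS ?yS ?addr0.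
Qed.

Lemma mem0_perp S : 0 \in perp S.
Proof. by apply/perpP => w _; exact: dot0r. Qed.

Lemma perp_fullv x : (x \in perp {:T}%VS) = (x == 0).
Proof.
apply/idP/eqP => [/perpP x_perp|->]; last exact: mem0_perp.
apply/eqP/contraT => /dot_nondegenerate[w /eqP]; case.
by rewrite x_perp ?memvf.
Qed.

Definition perp_coset S x : {set T} := [set y | x + y \in perp S].

Lemma mem_perp_coset S x y : (y \in perp_coset S x) = (x + y \in perp S).
Proof. by rewrite inE. Qed.

Lemma card_perp_coset S x : #|perp_coset S x| = #|perp S|.
Proof.
rewrite -(card_imset (mem (perp S)) (addrI x)); apply: eq_card => y.
rewrite mem_perp_coset; apply/idP/imsetP => [xyS|[z zS ->]].
  by exists (x + y) => //; rewrite (addKr_exp2 addxx_F2).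
by rewrite (addKr_exp2 addxx_F2).
Qed.

Lemma eq_perp_coset S x y :
  (perp_coset S x == perp_coset S y) = (x + y \in perp S).
Proof.
apply/eqP/idP => [/setP/(_ y)|xyS].
  by rewrite !mem_perp_coset addxx_F2 mem0_perp => ->.
have yxS : y + x \in perp S by rewrite addrC.
apply/setP => z; rewrite !mem_perp_coset; apply/idP/idP => [/(perpD yxS)|/(perpD xyS)];
  by rewrite (addrKA_exp2 addxx_F2).
Qed.

End DotProduct.
Arguments addxx_F2 {n} x.

Section FiniteFourier.
Variables (R : realFieldType) (n : nat).
Local Notation T := 'rV['F_2]_n.
Implicit Types (w x y : T) (f g : T -> R) (V : {vspace T}).

Definition chi w x : R := (-1) ^+ dot w x.

Lemma chi_eq1 w x : dot w x = 0 -> chi w x = 1.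
Proof. by rewrite /chi => ->. Qed.

Lemma chi_eqN1 w x : dot w x != 0 -> chi w x = -1.
Proof. by rewrite /chi; case: (dot w x) => [[|[|]]]. Qed.

Lemma chiC w x : chi w x = chi x w.
Proof. by rewrite /chi dotC. Qed.

Lemma chiDr w x y : chi w (x + y) = chi w x * chi w y.
Proof.
by rewrite /chi dotDr /= -exprD -[LHS]signr_odd -[RHS]signr_odd modn2 oddb.
Qed.

Lemma chiDl v w x : chi (v + w) x = chi v x * chi w x.
Proof. by rewrite !(chiC _ x) chiDr. Qed.

Lemma chi0r w : chi w 0 = 1.
Proof. by rewrite chi_eq1 ?dot0r. Qed.

Lemma chi0l x : chi 0 x = 1.
Proof. by rewrite chiC chi0r. Qed.

Lemma chi_mulK w x : chi w x * chi w x = 1.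
Proof. by rewrite -chiDr addxx_F2 chi0r. Qed.

Lemma normr_chi w x : `|chi w x| = 1.
Proof. by rewrite /chi normrX normrN1 expr1n. Qed.

Lemma sum_chi_vspace V x :
  \sum_(w in V) chi w x = (#|V|%:R : R) *+ (x \in perp V).
Proof.
have [/perpP x_perp|] := boolP (x \in perp V).
  rewrite (eq_bigr (fun=> 1)) ?sumr_const // => w wV.
  by rewrite chi_eq1 ?x_perp.
rewrite inE negb_forall_in => /exists_inP[v vV /chi_eqN1 chi_v].
have : \sum_(w in V) chi w x = \sum_(w in V) chi (w + v) x.
  rewrite (reindex_inj (addIr v)) /=; apply: eq_bigl => w; exact: rpredDr.
under [RHS]eq_bigr do rewrite chiDl.
by rewrite -big_distrl /= chi_v mulr0n; lra.
Qed.

Lemma sum_chi x : \sum_w chi w x = #|{: T}|%:R *+ (x == 0).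
Proof.
rewrite -perp_fullv -(eq_card (fun y : T => memvf y)) -sum_chi_vspace.
by apply: eq_bigl => w; rewrite memvf.
Qed.

Lemma mean_chi w : mean (chi w) = (w == 0)%:R.
Proof.
rewrite /mean; under eq_bigr do rewrite chiC.
by rewrite sum_chi mulrnAr mulVf // pnatr_eq0 -lt0n card_F2_gt0.
Qed.

Definition hat f w : R := mean (fun x => f x * chi w x).

Lemma eq_hat f g w : f =1 g -> hat f w = hat g w.
Proof. by move=> fg; apply: eq_mean => x; rewrite fg. Qed.

Lemma hat0 f : hat f 0 = mean f.
Proof. by apply: eq_mean => x; rewrite chi0l mulr1. Qed.

Lemma hat_chi v w : hat (chi v) w = (v == w)%:R.
Proof.
rewrite /hat (@eq_mean _ _ _ (chi (v + w))) => [|x]; last by rewrite chiDl.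
by rewrite mean_chi -(subr_exp2 addxx_F2) subr_eq0.
Qed.

Lemma chi_inj : injective chi.
Proof.
move=> v w vw; have := hat_chi v w.
rewrite vw hat_chi eqxx; case: eqP => // _ /eqP.
by rewrite oner_eq0.
Qed.

Lemma hatD f g w : hat (fun x => f x + g x) w = hat f w + hat g w.
Proof. by rewrite -meanD; apply: eq_mean => x; rewrite mulrDl. Qed.

Lemma hatB f g w : hat (fun x => f x - g x) w = hat f w - hat g w.
Proof. by rewrite -meanB; apply: eq_mean => x; rewrite mulrBl. Qed.

Lemma hatZ a f w : hat (fun x => a * f x) w = a * hat f w.
Proof. by rewrite -meanZ; apply: eq_mean => x; rewrite mulrA. Qed.

Lemma mean_shift f y : mean (fun x => f (x + y)) = mean f.
Proof. by rewrite /mean [in RHS](reindex_inj (addIr y)). Qed.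

Lemma hatM_chi f v w : hat (fun x => chi v x * f x) w = hat f (v + w).
Proof. by apply: eq_mean => x; rewrite chiDl; ring. Qed.

Lemma ler_norm_hat f w : `|hat f w| <= mean (fun x => `|f x|).
Proof.
apply: le_trans (ler_norm_mean _) _; apply: ler_mean => x.
by rewrite normrM normr_chi mulr1.
Qed.

Lemma fourier_inversion f x : f x = \sum_w hat f w * chi w x.
Proof.
under eq_bigr => w _ do rewrite /hat /mean -mulrA big_distrl /=.
rewrite -big_distrr exchange_big /= (bigD1 x) //= [X in _ * (_ + X)]big1 => [|y yx].
  under eq_bigr do rewrite -mulrA chi_mulK mulr1.
  by rewrite sumr_const -[f x *+ _]mulr_natl addr0 mulKf // pnatr_eq0 -lt0n card_F2_gt0.
under eq_bigr do rewrite -mulrA -chiDr.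
by rewrite -big_distrr sum_chi /= -(subr_exp2 addxx_F2) subr_eq0 (negbTE yx) mulr0n mulr0.
Qed.

Lemma plancherel f g : mean (fun x => f x * g x) = \sum_w hat f w * hat g w.
Proof.
rewrite (@eq_mean _ _ _ (fun x => \sum_w hat f w * (g x * chi w x))) => [|x].
  by rewrite mean_sum; apply: eq_bigr => w _; rewrite meanZ.
rewrite {1}(fourier_inversion f) big_distrl /=.
by apply: eq_bigr => w _; ring.
Qed.

(* By [cond_expE] this is the average of [f] over the coset of [perp V] through [x]. *)
Definition cond_exp V f x : R := \sum_(w in V) hat f w * chi w x.

Lemma hat_cond_exp V f w : hat (cond_exp V f) w = if w \in V then hat f w else 0.
Proof.
rewrite /hat (@eq_mean _ _ _ (fun x => \sum_(v in V) hat f v * (chi v x * chi w x))).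
  rewrite mean_sum big_mkcond (bigD1 w) //= big1 => [|v vw].
    by rewrite meanZ -/(hat (chi w) w) hat_chi eqxx mulr1 addr0.
  by case: ifP => // _; rewrite meanZ -/(hat (chi v) w) hat_chi (negbTE vw) mulr0.
by move=> x; rewrite big_distrl; apply: eq_bigr => v _; rewrite /= mulrA.
Qed.

Lemma mean_cond_exp V f : mean (cond_exp V f) = mean f.
Proof. by rewrite -!hat0 hat_cond_exp mem0v. Qed.

Lemma mean_cond_expM V f g :
  mean (fun x => cond_exp V f x * g x) = \sum_(w in V) hat f w * hat g w.
Proof.
rewrite plancherel [RHS]big_mkcond; apply: eq_bigr => w _.
by rewrite hat_cond_exp; case: ifP; rewrite ?mul0r.
Qed.

Lemma mean_cond_exp_sqr V f :
  mean (fun x => cond_exp V f x * cond_exp V f x) = \sum_(w in V) hat f w ^+ 2.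
Proof. by rewrite mean_cond_expM; apply: eq_bigr => w wV; rewrite hat_cond_exp wV. Qed.

Lemma card_vspaceR_gt0 V : 0 < #|V|%:R :> R.
Proof. by rewrite ltr0n; apply/card_gt0P; exists 0; exact: mem0v. Qed.

Lemma card_perp V : #|V|%:R * #|perp V|%:R = #|{: T}|%:R :> R.
Proof.
have N0 : #|{: T}|%:R != 0 :> R by rewrite pnatr_eq0 -lt0n card_F2_gt0.
have : mean (fun x => \sum_(w in V) chi w x) = 1.
  rewrite mean_sum (bigD1 0) ?mem0v //= big1 => [|w /andP[_ /negbTE w0]].
    by rewrite mean_chi eqxx addr0.
  by rewrite mean_chi w0.
rewrite /mean; under eq_bigr do rewrite sum_chi_vspace mulrb.
rewrite -big_mkcond sumr_const /= => /(congr1 ( *%R #|{: T}|%:R)).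
by rewrite mulr1 mulVKf // mulr_natr.
Qed.

Definition mean_on (A : {set T}) f : R := #|A|%:R^-1 * \sum_(y in A) f y.

Lemma cond_expE V f x : cond_exp V f x = mean_on (perp_coset V x) f.
Proof.
rewrite /cond_exp; under eq_bigr => w _ do rewrite /hat /mean -mulrA big_distrl /=.
rewrite -big_distrr exchange_big /= (eq_bigr (fun y => #|V|%:R *
    if y \in perp_coset V x then f y else 0)) => [|y _].
  rewrite -big_distrr -big_mkcond /mean_on card_perp_coset -(card_perp V) invfM /=.
  by rewrite mulrAC -!mulrA mulKf ?gt_eqF ?card_vspaceR_gt0 // mulrC.
under eq_bigr => w _ do rewrite -mulrA -chiDr.
rewrite -big_distrr sum_chi_vspace mem_perp_coset addrC /=.
by case: ifP => _; rewrite ?mulr0 // mulrC.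
Qed.

Lemma mean_on_itv (A : {set T}) f :
  (forall y, 0 <= f y <= 1) -> 0 <= mean_on A f <= 1.
Proof.
move=> f01; rewrite /mean_on mulr_ge0 ?invr_ge0 ?sumr_ge0 //=; last first.
  by move=> y _; case/andP: (f01 y).
have [->|A0] := posnP #|A|; first by rewrite invr0 mul0r ler01.
rewrite ler_pdivrMl ?ltr0n // mulr1 -sum1_card natr_sum.
by apply: ler_sum => y _; case/andP: (f01 y).
Qed.

Lemma cond_exp_itv V f x : (forall y, 0 <= f y <= 1) -> 0 <= cond_exp V f x <= 1.
Proof. by move=> f01; rewrite cond_expE mean_on_itv. Qed.

Lemma mean_perp_coset V (F : {set T} -> R) :
  #|V|%:R * mean (F \o perp_coset V) =
  \sum_(C in [set perp_coset V x | x in T]%SET) F C.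
Proof.
have /gt_eqF N0 : 0 < #|{: T}|%:R :> R by rewrite ltr0n card_F2_gt0.
rewrite /mean (partition_big_imset (perp_coset V)) mulrA.
rewrite big_distrr; apply: eq_bigr => _ /imsetP[x _ ->] /=.
rewrite (eq_bigr (fun=> F (perp_coset V x))) => [|y /eqP -> //].
rewrite (eq_bigl (fun y => y \in perp_coset V x)) => [|y]; last first.
  by rewrite eq_perp_coset mem_perp_coset addrC.
by rewrite sumr_const card_perp_coset -[F _ *+ _]mulr_natl mulrACA card_perp mulVKf ?N0.
Qed.

Lemma bernoulli_var_cond_exp V f :
  bernoulli_var (cond_exp V f) = mean f - \sum_(w in V) hat f w ^+ 2.
Proof. by rewrite bernoulli_varE mean_cond_exp mean_cond_exp_sqr. Qed.

Lemma sum_sqr_hat_notin V f :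
  \sum_(w | w \notin V) hat f w ^+ 2 = bernoulli_var (cond_exp V f) - bernoulli_var f.
Proof.
rewrite bernoulli_var_cond_exp bernoulli_varE.
have -> : mean (fun x => f x * f x) = \sum_w hat f w ^+ 2 by exact: plancherel.
by rewrite [X in _ - (_ - X)](bigID (mem V)) /=; ring.
Qed.

Lemma hat_sub_cond_exp V f w : w \notin V ->
  hat (fun x => f x - cond_exp V f x) w = hat f w.
Proof. by move=> /negbTE wV; rewrite hatB hat_cond_exp wV subr0. Qed.

Lemma mean_norm_sub_cond_exp V f : (forall x, 0 <= f x <= 1) ->
  mean (fun x => `|f x - cond_exp V f x|) <= 2 * bernoulli_var (cond_exp V f).
Proof.
move=> f01; have -> : 2 * bernoulli_var (cond_exp V f) =
    mean (fun x => f x + cond_exp V f x - 2 * (cond_exp V f x * f x)).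
  by rewrite meanB meanD meanZ mean_cond_expM mean_cond_exp bernoulli_var_cond_exp; ring.
apply: ler_mean => x; have /andP[f0 f1] := f01 x.
have /andP[p0 p1] := cond_exp_itv V x f01.
by rewrite ler_norml; apply/andP; split; nra.
Qed.

Lemma ler_hat_notin V f w : (forall x, 0 <= f x <= 1) -> w \notin V ->
  `|hat f w| <= 2 * bernoulli_var (cond_exp V f).
Proof.
move=> f01 wV; rewrite -(hat_sub_cond_exp f wV).
exact: le_trans (ler_norm_hat _ _) (mean_norm_sub_cond_exp V f01).
Qed.

End FiniteFourier.

(** * Fractional parts *)

Section Sawtooth.
Variable R : realType.
Implicit Types s t : R.

Definition sawtooth t : R := fracpart t * (1 - fracpart t).

Lemma fracpart_itv t : 0 <= fracpart t < 1.
Proof.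
rewrite /fracpart subr_ge0 ltrBlDl floor_le_tmp /=.
by have := floorD1_gt t; rewrite intrD.
Qed.

Lemma fracpart_unique t a (m : int) : t = m%:~R + a -> 0 <= a < 1 -> fracpart t = a.
Proof.
move=> -> /andP[a0 a1]; rewrite /fracpart (@floor_def _ _ m); first by ring.
by rewrite intrD lerDl a0 ltrD2l a1.
Qed.

Lemma sawtooth_itv t : 0 <= t <= 1 -> sawtooth t = t * (1 - t).
Proof.
case/andP=> t0; rewrite le_eqVlt => /orP[/eqP ->|t1].
  by rewrite /sawtooth (@fracpart_unique _ 0 1) ?lexx ?ltr01 ?addr0 //; ring.
by rewrite /sawtooth (@fracpart_unique _ t 0) ?add0r ?t0.
Qed.

Lemma sawtoothD s t : sawtooth (s + t) <= sawtooth s + sawtooth t.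
Proof.
have /andP[a0 a1] := fracpart_itv s; have /andP[b0 b1] := fracpart_itv t.
have s_floor : s = (Num.floor s)%:~R + fracpart s by rewrite /fracpart; ring.
have t_floor : t = (Num.floor t)%:~R + fracpart t by rewrite /fracpart; ring.
rewrite /sawtooth; move: (fracpart s) (fracpart t) a0 a1 b0 b1 s_floor t_floor => a b *.
have [ab|ab] := ltP (a + b) 1.
  rewrite (@fracpart_unique _ (a + b) (Num.floor s + Num.floor t)); first by nra.
    by rewrite intrD; lra.
  by lra.
rewrite (@fracpart_unique _ (a + b - 1) (Num.floor s + Num.floor t + 1)); first by nra.
  by rewrite !intrD; lra.
by lra.
Qed.

Lemma sawtooth_sum (I : Type) (r : seq I) (P : pred I) (F : I -> R) :
  (forall i, P i -> 0 <= F i <= 1) ->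
  sawtooth (\sum_(i <- r | P i) F i) <= \sum_(i <- r | P i) F i * (1 - F i).
Proof.
move=> F01; elim/big_rec2: _ => [|i y x Pi yx].
  by rewrite sawtooth_itv ?lexx ?ler01 // mul0r.
by apply: le_trans (sawtoothD _ _) _; rewrite sawtooth_itv ?F01 // lerD2l.
Qed.

Lemma sawtooth_le_bernoulli_var n (V : {vspace 'rV['F_2]_n}) (f : 'rV['F_2]_n -> R) :
  (forall x, 0 <= f x <= 1) ->
  sawtooth (mean f * #|V|%:R) <= #|V|%:R * bernoulli_var (cond_exp V f).
Proof.
move=> f01; rewrite -(mean_cond_exp V) mulrC.
have mean_blocks (h : R -> R) : #|V|%:R * mean (fun x => h (cond_exp V f x)) =
    \sum_(C in [set perp_coset V x | x in 'rV_n]%SET) h (mean_on C f).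
  rewrite -(mean_perp_coset V (fun C => h (mean_on C f))); congr (_ * _).
  by apply: eq_mean => x; rewrite cond_expE.
rewrite (mean_blocks id) /bernoulli_var (mean_blocks (fun u => u * (1 - u))).
by apply: sawtooth_sum => C _; exact: mean_on_itv.
Qed.

End Sawtooth.

(** * Riesz products and Chang's inequality *)

Lemma ln_ge1Vx (R : realType) (x : R) : 0 < x -> 1 - x^-1 <= ln x.
Proof.
move=> x0; have xV : x^-1 = 1 + (x^-1 - 1) by rewrite addrC subrK.
rewrite -[leRHS]opprK -lnV ?posrE // xV lerNr opprB.
by rewrite {2}xV (le_trans (le_ln1Dx _)) //; have := x0; rewrite -invr_gt0; lra.
Qed.

Lemma expR_le_mul1D (R : realType) (u : R) :
  `|u| <= 1 / 2 -> expR u <= expR (2 * u ^+ 2) * (1 + u).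
Proof.
rewrite ler_norml => /andP[u1 u2].
have -> : 2 * u ^+ 2 = u + (2 * u ^+ 2 - u) by ring.
rewrite expRD -mulrA ler_peMr ?expR_ge0 //.
have := expR_ge1Dx (2 * u ^+ 2 - u); nra.
Qed.

Section RieszProducts.
Variables (R : realType) (n : nat).
Local Notation T := 'rV['F_2]_n.
Local Notation chi := (@chi R n).
Implicit Types (a g f : T -> R) (s : seq T) (w x : T).

Definition riesz a s x : R := \prod_(l <- s) (1 + a l * chi l x).

Lemma hat_riesz_cons a l s w :
  hat (riesz a (l :: s)) w = hat (riesz a s) w + a l * hat (riesz a s) (l + w).
Proof.
rewrite -hatM_chi -hatZ -hatD; apply: eq_hat => x.
by rewrite /riesz big_cons; ring.
Qed.

Lemma hat_riesz_nil a w : hat (riesz a [::]) w = (0 == w)%:R.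
Proof. by rewrite -hat_chi; apply: eq_hat => x; rewrite /riesz big_nil chi0l. Qed.

Lemma hat_riesz_notin_span a s w : w \notin << s >>%VS -> hat (riesz a s) w = 0.
Proof.
elim: s w => [|l s IHs] w.
  by rewrite span_nil memv0 hat_riesz_nil eq_sym => /negbTE ->.
rewrite span_cons hat_riesz_cons => w_notin.
rewrite !IHs ?mulr0 ?addr0 //; apply: contra w_notin.
  by move=> lw; rewrite -(addKr_exp2 addxx_F2 l w) memv_add ?memv_line.
exact/subvP/addvSr.
Qed.

Lemma mean_riesz a s : free s -> mean (riesz a s) = 1.
Proof.
rewrite -hat0; elim: s => [|l s IHs]; first by rewrite hat_riesz_nil eqxx.
rewrite free_cons hat_riesz_cons => /andP[l_notin /IHs ->].
by rewrite addr0 hat_riesz_notin_span // mulr0 addr0.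
Qed.

Lemma expR_sum_chi_le_riesz t g s x : 0 <= t <= 1 / 2 -> (forall l, `|g l| <= 1) ->
  expR (t * \sum_(l <- s) g l * chi l x)
    <= expR (2 * (size s)%:R * t ^+ 2) * riesz (fun l => t * g l) s x.
Proof.
move=> /andP[t0 t1] g1; elim: s => [|l s IHs].
  by rewrite /riesz !big_nil !(mulr0, mul0r, mulr1).
set u := t * g l * chi l x; set k := (size s)%:R in IHs *.
have u_le : `|u| <= t by rewrite !normrM normr_chi mulr1 (ger0_norm t0) ler_piMr.
have u2_le : u ^+ 2 <= t ^+ 2 by rewrite -real_normK ?num_real // ler_sqr ?nnegrE.
have -> : t * \sum_(j <- l :: s) g j * chi j x = u + t * \sum_(j <- s) g j * chi j x.
  by rewrite big_cons mulrDr mulrA.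
rewrite /riesz big_cons -/(riesz _ _ _) expRD.
apply: le_trans (ler_pM (expR_ge0 _) (expR_ge0 _)
  (expR_le_mul1D (le_trans u_le t1)) IHs) _.
have riesz_ge0 : 0 <= riesz (fun l => t * g l) s x.
  by have := le_trans (expR_ge0 _) IHs; rewrite pmulr_rge0 ?expR_gt0.
rewrite mulrACA -expRD -/u; apply: ler_wpM2r.
  by apply: mulr_ge0 => //; move: (le_trans u_le t1); rewrite ler_norml; lra.
by rewrite ler_expR /= -natr1 -/k; lra.
Qed.

Lemma mean_expR_sum_chi_le t g s : free s -> 0 <= t <= 1 / 2 -> (forall l, `|g l| <= 1) ->
  mean (fun x => expR (t * \sum_(l <- s) g l * chi l x))
    <= expR (2 * (size s)%:R * t ^+ 2).
Proof.
move=> s_free t01 g1.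
rewrite -[leRHS]mulr1 -[X in _ * X](mean_riesz (fun l => t * g l) s_free) -meanZ.
by apply: ler_mean => x; exact: expR_sum_chi_le_riesz.
Qed.

Lemma rudin_inequality t g s : free s -> 0 <= t <= 1 / 2 -> (forall l, `|g l| <= 1) ->
  mean (fun x => expR (t * `|\sum_(l <- s) g l * chi l x|))
    <= 2 * expR (2 * (size s)%:R * t ^+ 2).
Proof.
move=> s_free t01 g1; pose P g x := \sum_(l <- s) g l * chi l x.
have PN x : P (\- g) x = - P g x.
  by rewrite /P -sumrN; apply: eq_bigr => l _; rewrite mulNr.
apply: le_trans (_ : mean (fun x => expR (t * P g x) + expR (t * P (\- g) x)) <= _).
  apply: ler_mean => x; rewrite PN -/(P g x); case: ler0P => _.
    by rewrite lerDr expR_ge0.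
  by rewrite lerDl expR_ge0.
rewrite meanD mulr_natl mulr2n; apply: lerD; apply: mean_expR_sum_chi_le => // l.
by rewrite normrN.
Qed.

Lemma sum_norm_hat_le f s :
  \sum_(l <- s) `|hat f l| <=
    mean (fun x => `|f x| * `|\sum_(l <- s) Num.sg (hat f l) * chi l x|).
Proof.
apply: le_trans (_ : mean (fun x =>
    f x * \sum_(l <- s) Num.sg (hat f l) * chi l x) <= _); last first.
  by apply: ler_mean => x; rewrite -normrM ler_norm.
rewrite (@eq_mean _ _ _ (fun x => \sum_(l <- s) Num.sg (hat f l) * (f x * chi l x))).
  by rewrite mean_sum; apply: ler_sum => l _; rewrite meanZ normrEsg.
by move=> x; rewrite big_distrr; apply: eq_bigr => l _ /=; ring.
Qed.

(* This is [1 + z <= expR z] at [z = t * `|P x| - u], where [P] is the sum of the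
   characters of [s] with the signs of [hat f]. *)
Lemma chang_expR f s t u : (forall x, `|f x| <= 1) -> free s -> 0 <= t <= 1 / 2 ->
  (1 - u) * mean (fun x => `|f x|) + t * \sum_(l <- s) `|hat f l|
    <= 2 * expR (2 * (size s)%:R * t ^+ 2 - u).
Proof.
move=> f1 s_free t01; have /andP[t0 _] := t01.
pose P x := \sum_(l <- s) Num.sg (hat f l) * chi l x.
apply: le_trans (_ : (1 - u) * mean (fun x => `|f x|)
    + t * mean (fun x => `|f x| * `|P x|) <= _).
  by rewrite lerD2l ler_wpM2l ?sum_norm_hat_le.
apply: le_trans (_ : expR (- u) * mean (fun x => expR (t * `|P x|)) <= _).
  rewrite -!meanZ -meanD; apply: ler_mean => x; rewrite -expRD.
  apply: le_trans (_ : `|f x| * expR (- u + t * `|P x|) <= _); last first.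
    by rewrite ler_piMl ?expR_ge0.
  have -> : (1 - u) * `|f x| + t * (`|f x| * `|P x|) =
      `|f x| * (1 + (- u + t * `|P x|)) by ring.
  by rewrite ler_wpM2l ?expR_ge1Dx.
rewrite expRD mulrA [leRHS]mulrC; apply: ler_wpM2l; first exact: expR_ge0.
by apply: rudin_inequality => // l; rewrite normr_sg lern1; case: (_ != 0).
Qed.

Lemma chang_inequality f s eta rho :
  (forall x, `|f x| <= 1) -> mean (fun x => `|f x|) <= eta -> 0 < eta <= 1 / 2 ->
  0 < rho <= 1 -> free s ->
  {in s, forall l, rho * eta <= `|hat f l|} ->
  (size s)%:R * rho ^+ 2 <= 8 * ln (4 / eta).
Proof.
move=> f1 f_eta /andP[eta0 eta1] /andP[rho0 rho1] s_free s_large.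
set k : R := (size s)%:R; have k0 : 0 <= k by rewrite /k.
have eta4 : 0 < 4 / eta by rewrite divr_gt0.
have [small|big] := leP (k * rho ^+ 2) 2.
  by have := ln_ge1Vx eta4; rewrite invf_div; lra.
have t01 : 0 <= rho / 4 <= 1 / 2 by lra.
have mass : k * (rho * eta) <= \sum_(l <- s) `|hat f l|.
  rewrite /k -sum1_size natr_sum big_distrl /= big_seq [leRHS]big_seq.
  by apply: ler_sum => l ls; rewrite mul1r s_large.
pose u := 1 / 2 + k * rho ^+ 2 / 4; have u_gt1 : 1 < u by rewrite /u; lra.
have lower : eta / 2 <= (1 - u) * mean (fun x => `|f x|)
    + rho / 4 * \sum_(l <- s) `|hat f l|.
  have : (u - 1) * mean (fun x => `|f x|) <= (u - 1) * eta.
    by rewrite ler_wpM2l // subr_ge0 ltW.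
  have : rho / 4 * (k * (rho * eta)) <= rho / 4 * \sum_(l <- s) `|hat f l|.
    by rewrite ler_wpM2l //; case/andP: t01.
  by rewrite /u; lra.
have eta_le : eta / 2 <= 2 * expR (- (k * rho ^+ 2 / 8)).
  apply: le_trans lower (le_trans (chang_expR u f1 s_free t01) _).
  by rewrite ler_pM2l // ler_expR -/k /u; lra.
have : ln (eta / 4) <= - (k * rho ^+ 2 / 8).
  by rewrite -[leRHS]expRK ler_ln ?posrE ?expR_gt0 //; lra.
by rewrite -invf_div lnV ?posrE //; lra.
Qed.

End RieszProducts.

(** * The increment step *)

Section DyadicPigeonhole.
Variable R : archiRealFieldType.

Lemma ler_dyadic_layers (r c : R) n : 0 <= c -> r <= c ->
  r <= c * (\sum_(1 <= i < n.+1) (if 2^-1 ^+ i * c < r then 2^-1 ^+ i else 0) + 2^-1 ^+ n).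
Proof.
move=> c0 rc; elim: n => [|n IHn]; first by rewrite big_geq // add0r expr0 mulr1.
rewrite big_nat_recr //=; case: ifPn => [_|].
  by rewrite -addrA exprS; apply: le_trans IHn _; lra.
rewrite -leNgt => r_le; apply: le_trans r_le _.
rewrite addr0 mulrDr mulrC lerDr mulr_ge0 // sumr_ge0 // => i _.
by case: ifP => // _; rewrite exprn_ge0 // invr_ge0.
Qed.

Lemma sum_half_expr_mul_nat_le2 n : \sum_(1 <= i < n.+1) (2^-1 : R) ^+ i * i%:R <= 2.
Proof.
suff -> : \sum_(1 <= i < n.+1) (2^-1 : R) ^+ i * i%:R = 2 - (n%:R + 2) * 2^-1 ^+ n.
  by rewrite lerBlDr lerDl mulr_ge0 ?exprn_ge0 ?invr_ge0 // addr_ge0.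
elim: n => [|n IHn]; first by rewrite big_geq // expr0; ring.
by rewrite big_nat_recr //= IHn exprS -natr1; field.
Qed.

Variables (I : finType) (P : pred I) (r : I -> R) (c : R).
Hypotheses (c0 : 0 < c) (r_itv : forall w, P w -> 0 <= r w <= c).

Lemma sum_sqr_le_dyadic n :
  \sum_(w | P w) r w ^+ 2 <=
    c * (\sum_(1 <= i < n.+1) 2^-1 ^+ i * (\sum_(w | P w && (2^-1 ^+ i * c < r w)) r w)
         + 2^-1 ^+ n * \sum_(w | P w) r w).
Proof.
have -> : \sum_(1 <= i < n.+1) 2^-1 ^+ i * (\sum_(w | P w && (2^-1 ^+ i * c < r w)) r w) =
    \sum_(w | P w)
      (\sum_(1 <= i < n.+1) if 2^-1 ^+ i * c < r w then 2^-1 ^+ i else 0) * r w.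
  under [RHS]eq_bigr do rewrite big_distrl /=.
  rewrite exchange_big; apply: eq_bigr => i _ /=.
  rewrite big_distrr big_mkcondr; apply: eq_bigr => w _ /=.
  by case: ifP => _; rewrite ?mul0r.
rewrite big_distrr -big_split big_distrr; apply: ler_sum => w Pw /=.
have /andP[r0 rc] := r_itv Pw.
rewrite -mulrDl mulrA expr2; apply: ler_wpM2r => //.
exact: ler_dyadic_layers (ltW c0) rc.
Qed.

Lemma dyadic_pigeonhole : c / 4 <= \sum_(w | P w) r w ^+ 2 ->
  exists2 i, (0 < i)%N & i%:R / 16 <= \sum_(w | P w && (2^-1 ^+ i * c < r w)) r w.
Proof.
move=> sqr_ge; apply: contrapT => no_layer.
have layer_le i : (0 < i)%N ->
    \sum_(w | P w && (2^-1 ^+ i * c < r w)) r w <= i%:R / 16.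
  move=> i0; rewrite leNgt; apply/negP => layer_gt.
  by apply: no_layer; exists i => //; exact: ltW.
pose S := \sum_(w | P w) r w; pose n := Num.bound (16 * S).
have tail_le : 2^-1 ^+ n * S <= 1 / 16.
  have := upper_nthrootP (leqnn n); rewrite exprVn ler_pdivrMl ?exprn_gt0 //; lra.
have layers_le : \sum_(1 <= i < n.+1) 2^-1 ^+ i *
    (\sum_(w | P w && (2^-1 ^+ i * c < r w)) r w) <= 1 / 8.
  apply: le_trans (_ : (\sum_(1 <= i < n.+1) 2^-1 ^+ i * i%:R) / 16 <= _); last first.
    by have := sum_half_expr_mul_nat_le2 n; lra.
  rewrite big_distrl [leLHS]big_nat [leRHS]big_nat; apply: ler_sum => i /andP[i0 _] /=.
  by rewrite -mulrA ler_wpM2l ?exprn_ge0 ?invr_ge0 // layer_le.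
suff : c / 4 <= c * (1 / 8 + 1 / 16) by rewrite ler_pM2l // leNgt => /negP[]; lra.
apply: le_trans sqr_ge (le_trans (sum_sqr_le_dyadic n) _).
by rewrite ler_pM2l // lerD.
Qed.

End DyadicPigeonhole.

Lemma free_subseq_span (K : fieldType) (vT : vectType K) (X : seq vT) :
  exists s, [/\ {subset s <= X}, free s & << s >>%VS = << X >>%VS].
Proof.
elim: X => [|v X [s [sX s_free sE]]]; first by exists [::]; rewrite nil_free.
have [vX|vX] := boolP (v \in << X >>%VS).
  exists s; split=> // [x /sX|]; first by rewrite in_cons orbC => ->.
  by rewrite sE span_cons; apply/esym/addv_idPr; rewrite -memvE.
exists (v :: s); split; last by rewrite !span_cons sE.
  by move=> x; rewrite !in_cons => /predU1P[->|/sX ->]; rewrite ?eqxx ?orbT.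
by rewrite free_cons sE vX.
Qed.

Lemma card_vspace_F2 n (V : {vspace 'rV['F_2]_n}) : #|V| = (2 ^ \dim V)%N.
Proof. by rewrite card_vspace card_Fp. Qed.

Lemma ler_sum_subpred (R : numDomainType) (I : finType) (P Q : pred I) (F : I -> R) :
  subpred P Q -> (forall i, 0 <= F i) -> \sum_(i | P i) F i <= \sum_(i | Q i) F i.
Proof.
move=> PQ F0; rewrite big_mkcond [leRHS]big_mkcond; apply: ler_sum => i _.
by case: ifP => [/PQ -> //|_]; case: ifP.
Qed.

Lemma ln_card_vspace_le (R : realType) n (V : {vspace 'rV['F_2]_n}) :
  ln #|V|%:R <= (\dim V)%:R :> R.
Proof.
rewrite card_vspace_F2 natrX lnXn // -[ln _ *+ _]mulr_natr ler_piMl //.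
by have := @le_ln1Dx R 1; apply; lra.
Qed.

Section Increment.
Variables (R : realType) (n : nat) (b : 'rV['F_2]_n -> R).
Hypothesis b01 : forall x, 0 <= b x <= 1.
Implicit Type V : {vspace 'rV['F_2]_n}.

Local Notation var V := (bernoulli_var (cond_exp V b)).

Definition large_spectrum V (rho : R) : {set 'rV['F_2]_n} :=
  [set w | (w \notin V) && (rho * (2 * var V) < `|hat b w|)].

Lemma dim_span_large_spectrum V rho : 0 < var V -> 0 < rho <= 1 ->
  (\dim << enum (large_spectrum V rho) >>)%:R * rho ^+ 2 <= 8 * ln (2 / var V).
Proof.
move=> var0 rho01.
have [s [sL s_free <-]] := free_subseq_span (enum (large_spectrum V rho)).
have sP l : l \in s -> (l \notin V) && (rho * (2 * var V) < `|hat b l|).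
  by move=> /sL; rewrite mem_enum inE.
have -> : 2 / var V = 4 / (2 * var V) by field; rewrite gt_eqF.
have /eqP -> : \dim << s >> == size s by [].
apply: (chang_inequality (f := fun x => b x - cond_exp V b x)) => //.
- move=> x; have /andP[b0 b1] := b01 x; have /andP[p0 p1] := cond_exp_itv V x b01.
  by rewrite ler_norml; lra.
- exact: mean_norm_sub_cond_exp.
- by have := bernoulli_var_le (card_F2_gt0 n) (cond_exp V b); lra.
- by move=> l /sP /andP[lV /ltW]; rewrite hat_sub_cond_exp.
Qed.

Lemma large_spectrum_mass V : 0 < var V -> bernoulli_var b <= var V / 2 ->
  exists2 i, (0 < i)%N & i%:R / 16 <= \sum_(w in large_spectrum V (2^-1 ^+ i)) `|hat b w|.
Proof.
move=> var0 b_var.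
have [|w wV||i i0 mass] := @dyadic_pigeonhole R _ (fun w => w \notin V)
    (fun w => `|hat b w|) (2 * var V).
- by rewrite mulr_gt0.
- by rewrite normr_ge0 ler_hat_notin.
- under eq_bigr do rewrite real_normK ?num_real //.
  by rewrite sum_sqr_hat_notin; lra.
exists i => //; rewrite (eq_bigl (fun w => (w \notin V) &&
  (2^-1 ^+ i * (2 * var V) < `|hat b w|))) // => w.
by rewrite inE.
Qed.

Lemma l1_mass_increment V : 0 < var V -> bernoulli_var b <= var V / 2 ->
  exists (V' : {vspace 'rV['F_2]_n}) (i : nat),
    [/\ (V <= V')%VS, (0 < i)%N,
        (\dim V')%:R <= (\dim V)%:R + 8 * 4 ^+ i * ln (2 / var V) &
        \sum_(w in V) `|hat b w| + i%:R / 16 <= \sum_(w in V') `|hat b w|].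
Proof.
move=> var0 b_var; have [i i0 mass] := large_spectrum_mass var0 b_var.
set L := large_spectrum V _ in mass; pose W := << enum L >>%VS.
have rho01 : 0 < (2^-1 : R) ^+ i <= 1.
  by rewrite exprn_gt0 ?invr_gt0 //= exprn_ile1 //; lra.
exists (V + W)%VS, i; split=> //; first exact: addvSl.
  apply: le_trans (_ : (\dim V + \dim W)%:R <= _); first by rewrite ler_nat dimv_add_leqif.
  rewrite natrD lerD2l mulrAC -ler_pdivrMr ?exprn_gt0 //.
  have rho_sqr : (2^-1 ^+ i) ^+ 2 = (4 ^+ i)^-1 :> R.
    by rewrite -exprVn -exprM mulnC exprM; congr (_ ^+ _); field.
  by have := dim_span_large_spectrum var0 rho01; rewrite rho_sqr.
rewrite [leRHS](bigID (mem V)) /=; apply: lerD.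
  by apply: ler_sum_subpred => // w wV; rewrite wV andbT; apply: subvP wV; exact: addvSl.
apply: le_trans mass _; apply: ler_sum_subpred => // w wL.
rewrite (subvP (addvSr _ _) _ (memv_span _)) ?mem_enum //.
by move: wL; rewrite inE => /andP[].
Qed.

End Increment.

(** * The doubly logarithmic lower bound *)

Lemma ln_le_add_ln36 (R : realType) (i : nat) (x y : R) : (0 < i)%N -> 0 < x -> 0 < y ->
  y <= x + 8 * 4 ^+ i * x -> ln y <= ln x + i%:R * ln 36.
Proof.
move=> i0 x0 y0 y_le.
have pow36 : 1 + 8 * 4 ^+ i <= 36 ^+ i :> R.
  have four : 1 <= 4 ^+ i :> R by rewrite exprn_ege1 //; lra.
  have nine : 9 <= 9 ^+ i :> R by rewrite -{1}(expr1 9) ler_weXn2l //; lra.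
  have -> : 36 = 9 * 4 :> R by ring.
  rewrite exprMn; apply: le_trans (_ : 9 * 4 ^+ i <= _); first by lra.
  by rewrite ler_wpM2r // exprn_ge0.
have : y <= x * 36 ^+ i.
  by apply: le_trans y_le _; have := ler_wpM2l (ltW x0) pow36; lra.
rewrite -ler_ln ?posrE ?mulr_gt0 ?exprn_gt0 // lnM ?posrE ?exprn_gt0 // lnXn //.
by move=> /le_trans; apply; rewrite lerD2l mulr_natl.
Qed.

Lemma ln36_gt0 (R : realType) : 0 < ln 36 :> R.
Proof. by rewrite ln_gt0 // (_ : 1 = 1%:R) // ltr_nat. Qed.

Definition loglog_const (R : realType) (delta : R) : R :=
  (16 * ln 36 + `|ln (ln (2 / delta))| / delta)^-1.

Lemma loglog_const_gt0 (R : realType) (delta : R) : 0 < delta -> 0 < loglog_const delta.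
Proof.
move=> delta0; rewrite invr_gt0; apply: ltr_wpDr.
  by apply: divr_ge0 => //; exact: ltW.
by apply: mulr_gt0 => //; exact: ln36_gt0.
Qed.

Section LogLog.
Variables (R : realType) (n : nat) (b : 'rV['F_2]_n -> R) (delta M : R).
Hypothesis b01 : forall x, 0 <= b x <= 1.
Hypotheses (delta0 : 0 < delta) (M1 : 1 < M).
Hypothesis b_var : bernoulli_var b <= delta / (2 * M).
Hypothesis b_gap : forall V : {vspace 'rV['F_2]_n}, #|V|%:R <= M ->
  delta <= sawtooth (mean b * #|V|%:R).
Implicit Type V : {vspace 'rV['F_2]_n}.

Local Notation var V := (bernoulli_var (cond_exp V b)).
Local Notation L := (ln (2 / delta)).

Let M_gt0 : 0 < M. Proof. exact: lt_trans ltr01 M1. Qed.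

Lemma delta_div_card_le_var V : #|V|%:R <= M -> delta / #|V|%:R <= var V.
Proof.
move=> VM; rewrite ler_pdivrMr ?card_vspaceR_gt0 // mulrC.
exact: le_trans (b_gap VM) (sawtooth_le_bernoulli_var V b01).
Qed.

Lemma card_vspace0_le : #|(0%VS : {vspace 'rV['F_2]_n})|%:R <= M.
Proof. by rewrite card_vspace_F2 dimv0 ltW. Qed.

Lemma delta_le_mean : delta <= mean b.
Proof.
apply: le_trans (b_gap card_vspace0_le) _.
rewrite card_vspace_F2 dimv0 mulr1 sawtooth_itv ?mean_itv ?card_F2_gt0 //.
by have := sqr_ge0 (mean b); lra.
Qed.

Lemma ln_inv_delta_gt0 : 0 < L.
Proof.
have := delta_div_card_le_var card_vspace0_le; rewrite card_vspace_F2 dimv0 divr1.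
have := bernoulli_var_le (card_F2_gt0 n) (cond_exp 0%VS b).
by have := @ln_ge1Vx R (2 / delta); rewrite divr_gt0 // invf_div => /(_ isT); lra.
Qed.

Lemma ln_inv_var_le V : #|V|%:R <= M -> ln (2 / var V) <= (\dim V)%:R + L.
Proof.
move=> VM; have varV := delta_div_card_le_var VM; have V0 := card_vspaceR_gt0 R V.
have var0 : 0 < var V by apply: lt_le_trans varV; rewrite divr_gt0.
have inv_var_le : 2 / var V <= #|V|%:R * (2 / delta).
  rewrite mulrCA ler_pM2l // -[leRHS]invrK lef_pV2 ?posrE ?invr_gt0 ?divr_gt0 //.
  by rewrite invf_div.
apply: le_trans (_ : ln (#|V|%:R * (2 / delta)) <= _).
  by rewrite ler_ln // posrE ?divr_gt0 // mulr_gt0 ?divr_gt0.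
by rewrite lnM ?posrE ?divr_gt0 // lerD2r ln_card_vspace_le.
Qed.

Lemma dimD_ln_gt0 V : 0 < (\dim V)%:R + L.
Proof. by rewrite ltr_wpDl ?ln_inv_delta_gt0. Qed.

(* An increment gains [i / 16] of l1-mass while [\dim V + L] grows at most by the
   factor [36 ^+ i], so this bound is inherited from [V] by its increment. *)
Definition dim_mass_bound V : Prop :=
  ln ((\dim V)%:R + L) <= ln L + 16 * ln 36 * \sum_(w in V) `|hat b w|.

Lemma dim_mass_bound_increment V : #|V|%:R <= M -> dim_mass_bound V ->
  exists2 V', dim_mass_bound V' & (\dim V < \dim V')%N.
Proof.
move=> VM V_bound; have varV := delta_div_card_le_var VM.
have var0 : 0 < var V by apply: lt_le_trans varV; rewrite divr_gt0 ?card_vspaceR_gt0.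
have b_var_le : bernoulli_var b <= var V / 2.
  apply: le_trans b_var _; rewrite invfM mulrCA mulrC ler_pM2r ?invr_gt0 //.
  by apply: le_trans varV; rewrite ler_pM2l // lef_pV2 ?posrE ?card_vspaceR_gt0.
have [V' [i [VV' i0 dimV' mass]]] := l1_mass_increment b01 var0 b_var_le.
exists V'.
  have dim_le : (\dim V')%:R + L <=
      (\dim V)%:R + L + 8 * 4 ^+ i * ((\dim V)%:R + L).
    have : 8 * 4 ^+ i * ln (2 / var V) <= 8 * 4 ^+ i * ((\dim V)%:R + L).
      by rewrite ler_wpM2l ?ln_inv_var_le // mulr_ge0 ?exprn_ge0.
    by lra.
  apply: le_trans (ln_le_add_ln36 i0 (dimD_ln_gt0 V) (dimD_ln_gt0 V') dim_le) _.
  have : 16 * ln 36 * (\sum_(w in V) `|hat b w| + i%:R / 16) <=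
      16 * ln 36 * \sum_(w in V') `|hat b w|.
    by rewrite ler_wpM2l // mulr_ge0 ?(ltW (ln36_gt0 R)).
  by move: V_bound; rewrite /dim_mass_bound; lra.
rewrite ltn_neqAle dimvS // andbT (dimv_leqif_eq VV').2.
apply: contraTneq mass => <-.
have : 0 < i%:R :> R by rewrite ltr0n.
by rewrite -ltNge; lra.
Qed.

Lemma exists_dim_mass_bound : exists2 V, dim_mass_bound V & M < #|V|%:R.
Proof.
pose P d := `[< exists2 V, dim_mass_bound V & \dim V = d >].
have P0 : exists d, P d.
  exists 0%N; apply/asboolP; exists 0%VS; rewrite ?dimv0 //.
  rewrite /dim_mass_bound dimv0 add0r lerDl; apply: mulr_ge0; last exact: sumr_ge0.
  by rewrite mulr_ge0 ?(ltW (ln36_gt0 R)).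
have P_le d : P d -> (d <= n)%N.
  by move=> /asboolP[V _ <-]; have := dimvS (subvf V); rewrite dimvf /dim /= mul1n.
case: (ex_maxnP P0 P_le) => _ /asboolP[V V_bound <-] V_max.
exists V => //; rewrite ltNge; apply/negP => VM.
have [V' V'_bound] := dim_mass_bound_increment VM V_bound.
by rewrite ltnNge V_max //; apply/asboolP; exists V'.
Qed.

Lemma ler_sum_norm_hat_loglog : loglog_const delta * ln (ln M) <= \sum_w `|hat b w|.
Proof.
have [V V_bound MV] := exists_dim_mass_bound.
set S := \sum_w _.
have S_ge : delta <= S.
  apply: le_trans delta_le_mean _; rewrite -hat0 /S (bigD1 0) //=.
  by apply: le_trans (ler_norm _) _; rewrite lerDl sumr_ge0.
have V_le_S : 16 * ln 36 * \sum_(w in V) `|hat b w| <= 16 * ln 36 * S.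
  by rewrite ler_wpM2l ?mulr_ge0 ?(ltW (ln36_gt0 R)) //; exact: ler_sum_subpred.
have lnlnM : ln (ln M) <= ln ((\dim V)%:R + L).
  rewrite ler_ln ?posrE ?ln_gt0 ?dimD_ln_gt0 //.
  apply: le_trans (_ : ln #|V|%:R <= _).
    by rewrite ler_ln ?posrE ?card_vspaceR_gt0 // ltW.
  by apply: le_trans (ln_card_vspace_le R V) _; rewrite lerDl ltW ?ln_inv_delta_gt0.
have lnL : ln L <= `|ln L| / delta * S.
  apply: le_trans (ler_norm _) _; rewrite mulrAC ler_pdivlMr //.
  by rewrite ler_wpM2l.
rewrite ler_pdivrMl; last by rewrite -invr_gt0; exact: loglog_const_gt0.
by rewrite [leRHS]mulrDl; move: V_bound; rewrite /dim_mass_bound; lra.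
Qed.

End LogLog.

(** * Bogolyubov's theorem *)

Definition sumset (G : zmodType) (A B : set G) : set G := [set x + y | x in A & y in B].

Lemma sumsetS (G : zmodType) (A A' B B' : set G) :
  A `<=` A' -> B `<=` B' -> sumset A B `<=` sumset A' B'.
Proof.
by move=> AA' BB' _ [x Ax [y By <-]]; exists x; [exact: AA'|exists y; [exact: BB'|]].
Qed.

Definition sumset4 (G : zmodType) (A : set G) : set G := sumset (sumset A A) (sumset A A).

Lemma natr_mul_ge1_gt0 (R : realFieldType) (m : nat) (d : R) : 1 <= m%:R * d -> 0 < d.
Proof.
by move=> md1; rewrite ltNge; apply/negP => /(mulr_ge0_le0 (ler0n R m)); lra.
Qed.

Section Convolution.
Variables (R : realFieldType) (n : nat).
Local Notation T := 'rV['F_2]_n.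
Implicit Types (f g : T -> R) (S : {set T}).

Definition conv f g x : R := mean (fun y => f y * g (x + y)).

Lemma hat_conv f g w : hat (conv f g) w = hat f w * hat g w.
Proof.
pose F y := f y * chi R w y; pose G z := g z * chi R w z.
transitivity (mean (fun x => mean (fun y => F y * G (x + y)))).
  apply: eq_mean => x; rewrite mulrC -meanZ; apply: eq_mean => y.
  rewrite /F /G chiDr; have := chi_mulK R w y => chi2.
  by rewrite -[LHS]mulr1 -{1}chi2; ring.
transitivity (mean (fun y => mean (fun x => F y * G (x + y)))); first exact: exchange_mean.
rewrite (@eq_mean _ _ _ (fun y => hat g w * F y)) => [|y]; first by rewrite meanZ mulrC.
by rewrite meanZ (mean_shift G) mulrC.
Qed.

Lemma conv_neq0 f g x : conv f g x != 0 -> exists y, f y != 0 /\ g (x + y) != 0.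
Proof.
by move=> /mean_neq0[y]; rewrite mulf_eq0 negb_or => /andP[fy gy]; exists y.
Qed.

Lemma card_large_hat_le f c :
  #|[set w | c <= hat f w ^+ 2]%SET|%:R * c <= mean (fun x => f x ^+ 2).
Proof.
have -> : mean (fun x => f x ^+ 2) = \sum_w hat f w ^+ 2 by exact: plancherel.
rewrite mulr_natl -sumr_const big_mkcond; apply: ler_sum => w _ /=.
by rewrite inE; case: ifP => // _; exact: sqr_ge0.
Qed.

Definition fin_indic S (x : T) : R := (x \in S)%:R.

Lemma mean_fin_indic S : mean (fin_indic S) = #|S|%:R / #|{: T}|%:R.
Proof. by rewrite /mean mulrC /fin_indic -natr_sum -big_mkcond sum1_card. Qed.

Lemma mean_fin_indic_sqr S : mean (fun x => fin_indic S x ^+ 2) = mean (fin_indic S).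
Proof.
apply: eq_mean => x; rewrite /fin_indic.
by case: (x \in S); rewrite ?expr1n ?expr0n.
Qed.

Lemma mean_fin_indic_itv S : 0 <= mean (fin_indic S) <= 1.
Proof.
apply: mean_itv => [|x]; first exact: card_F2_gt0.
by rewrite /fin_indic; case: (x \in S); rewrite ?lexx ?ler01.
Qed.

Definition bogolyubov_spectrum S : {set T} :=
  [set w | mean (fin_indic S) ^+ 3 / 2 <= hat (fin_indic S) w ^+ 2].

Lemma card_bogolyubov_spectrum S m : 1 <= m%:R * mean (fin_indic S) ->
  (#|bogolyubov_spectrum S| <= 2 * m ^ 2)%N.
Proof.
move=> m_large; set d := mean _ in m_large.
have d0 : 0 < d := natr_mul_ge1_gt0 m_large.
have := card_large_hat_le (fin_indic S) (d ^+ 3 / 2).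
rewrite mean_fin_indic_sqr -/d -/(bogolyubov_spectrum S).
set k := #|_|%:R => card_le.
have k_le : k * d ^+ 2 <= 2.
  rewrite -(ler_pM2r d0); have -> : k * d ^+ 2 * d = 2 * (k * (d ^+ 3 / 2)) by field.
  by rewrite ler_pM2l.
rewrite -(ler_nat R) natrM natrX -/k.
apply: le_trans (_ : k * (m%:R * d) ^+ 2 <= _); first by rewrite ler_peMr ?exprn_ege1.
by rewrite exprMn mulrCA mulrC ler_wpM2r ?sqr_ge0.
Qed.

Lemma conv4_fin_indic_gt0 S t : 0 < mean (fin_indic S) ->
  t \in perp (bogolyubov_spectrum S) ->
  0 < conv (conv (fin_indic S) (fin_indic S)) (conv (fin_indic S) (fin_indic S)) t.
Proof.
set f := fin_indic S; set d := mean f => d0 /perpP t_perp.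
rewrite (fourier_inversion (conv _ _)).
rewrite (eq_bigr (fun w => hat f w ^+ 4 * chi R w t)) => [|w _]; last first.
  by rewrite !hat_conv; ring.
have specE w : (w \in bogolyubov_spectrum S) = (d ^+ 3 / 2 <= hat f w ^+ 2) by rewrite inE.
have main : d ^+ 4 <= \sum_(w in bogolyubov_spectrum S) hat f w ^+ 4 * chi R w t.
  rewrite (bigD1 0) /=; last first.
    have /andP[_ d1] := mean_fin_indic_itv S; rewrite specE hat0 -/d exprS.
    by have := sqr_ge0 d; rewrite -/d in d1; nra.
  rewrite hat0 chi0l mulr1 lerDl sumr_ge0 // => w /andP[wS _].
  by rewrite chi_eq1 ?t_perp // mulr1 exprn_even_ge0.
have tail : `|\sum_(w | w \notin bogolyubov_spectrum S) hat f w ^+ 4 * chi R w t|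
    <= d ^+ 4 / 2.
  apply: le_trans (ler_norm_sum _ _ _) _.
  apply: le_trans (_ : \sum_w (d ^+ 3 / 2) * hat f w ^+ 2 <= _).
    rewrite [leRHS](bigID (fun w => w \notin bogolyubov_spectrum S)) /= ler_wpDr //.
      by rewrite sumr_ge0 // => w _; rewrite mulr_ge0 ?sqr_ge0 ?divr_ge0 ?exprn_ge0 ?ltW.
    apply: ler_sum => w; rewrite specE -ltNge => hat_lt.
    rewrite normrM normr_chi mulr1 ger0_norm ?exprn_even_ge0 // (exprD _ 2 2).
    by apply: ler_wpM2r (ltW hat_lt); exact: sqr_ge0.
  rewrite -big_distrr /= (_ : \sum_w hat f w ^+ 2 = d); last first.
    by rewrite -[RHS]mean_fin_indic_sqr; exact/esym/plancherel.
  by have -> : d ^+ 3 / 2 * d = d ^+ 4 / 2 by field.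
rewrite (bigID (mem (bogolyubov_spectrum S))) /=.
have : 0 < d ^+ 4 by rewrite exprn_gt0.
by move: tail; rewrite ler_norml => /andP[tail _]; lra.
Qed.

End Convolution.

Lemma bogolyubov n (S : {set 'rV['F_2]_n}) m : (#|'rV['F_2]_n| <= m * #|S|)%N ->
  exists2 X : {set 'rV['F_2]_n}, (#|X| <= 2 * m ^ 2)%N &
    [set` perp X] `<=` sumset4 [set` S].
Proof.
move=> S_large; pose f := fin_indic rat S.
have m_large : 1 <= m%:R * mean f.
  by rewrite mean_fin_indic mulrA ler_pdivlMr ?ltr0n ?card_F2_gt0 // mul1r -natrM ler_nat.
have mean0 : 0 < mean f := natr_mul_ge1_gt0 m_large.
exists (bogolyubov_spectrum rat S); first exact: card_bogolyubov_spectrum.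
have fP x : f x != 0 -> x \in S by rewrite /f /fin_indic; case: (x \in S); rewrite ?eqxx.
have conv_sumset x : conv f f x != 0 -> sumset [set` S] [set` S] x.
  move=> /conv_neq0[y [/fP yS /fP xyS]]; exists (x + y) => //; exists y => //.
  exact: (addrK_exp2 addxx_F2).
move=> t /= /(conv4_fin_indic_gt0 mean0)/lt0r_neq0/conv_neq0[y [yS xyS]].
exists (t + y); first exact: conv_sumset.
by exists y; [exact: conv_sumset|exact: (addrK_exp2 addxx_F2)].
Qed.

(** * Subgroups of bounded index *)

Definition subgroup (G : zmodType) (H : set G) : Prop :=
  H 0 /\ forall x y, H x -> H y -> H (x - y).

Definition translates_cover (G : zmodType) (a : seq G) (C : set G) : Prop :=
  forall x, exists2 y, y \in a & C (x - y).

Definition cosets_met_le (G : zmodType) (W L : set G) (k : nat) : Prop :=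
  forall x : 'I_k.+1 -> G, (forall i, L (x i)) -> exists i j, i != j /\ W (x i - x j).

Section Subgroups.
Variable G : zmodType.
Implicit Types (x y : G) (H W D : set G).

Lemma subgroupN H x : subgroup H -> H x -> H (- x).
Proof. by case=> H0 HB Hx; rewrite -sub0r; exact: HB. Qed.

Lemma subgroupD H x y : subgroup H -> H x -> H y -> H (x + y).
Proof. by move=> sH Hx Hy; rewrite -[y]opprK; apply: sH.2 => //; exact: subgroupN. Qed.

Lemma subgroup_set0 : subgroup [set (0 : G)].
Proof. by split=> // x y -> ->; exact: subr0. Qed.

(* [W] is the limit of the subgroups [F L] along an ultrafilter on the finite lists [L]
   that refines inclusion. *)
Lemma subgroup_limit D k :
  (forall L : seq G, exists W,
     [/\ subgroup W, W `<=` D & cosets_met_le W [set` L] k]) ->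
  exists W, [/\ subgroup W, W `<=` D & cosets_met_le W setT k].
Proof.
move=> /boolp.choice[F FP].
pose incl : set_system (seq G) :=
  filter_from setT (fun L0 : seq G => [set L : seq G | {subset L0 <= L}]).
have incl_proper : ProperFilter incl.
  apply: filter_from_proper => [|L _]; last by exists L.
  apply: filter_from_filter => [|L L' _ _]; first by exists [::].
  exists (L ++ L') => // K LK; split=> x xL; apply: LK; by rewrite mem_cat xL ?orbT.
have [U [U_ultra incl_U]] := ultraFilterLemma incl_proper.
exists [set x | U [set L | F L x]]; split.
- split=> [|x y Ux Uy].
    by apply: filterS filterT => L _; case: (FP L) => [[]].
  by apply: filterS2 Ux Uy => L; case: (FP L) => [[_ +] _ _]; apply.
- by move=> x /filter_ex[L]; case: (FP L) => _ + _; apply.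
move=> x _; apply: contrapT => no_pair.
have apart i j : i != j -> U [set L | ~ F L (x i - x j)].
  move=> ij; have [Uij|//] := in_ultra_setVsetC [set L | F L (x i - x j)] U_ultra.
  by exfalso; apply: no_pair; exists i, j.
have all_apart : U [set L | forall i j, i != j -> ~ F L (x i - x j)].
  apply: filter_forall => i; apply: filter_forall => j.
  have [ij|ij] := eqVneq i j; first exact: nearW.
  by apply: filterS (apart i j ij) => L + _.
have all_in : U [set L : seq G | forall i, x i \in L].
  apply: incl_U; exists (codom x) => // L xL i; apply: xL; exact: codom_f.
have [L [L_apart L_in]] := filter_ex (filterI all_apart all_in).
by case: (FP L) => _ _ /(_ x L_in)[i [j [/L_apart]]].
Qed.

Lemma cosets_met_le_finite W k : subgroup W -> cosets_met_le W setT k ->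
  exists a : seq G, translates_cover a W.
Proof.
move=> sW W_index; pose apart x y := `[< ~ W (x - y) >].
have grow m : (exists a, translates_cover a W) \/
    exists2 l : seq G, size l = m & pairwise apart l.
  elim: m => [|m [?|[l szl l_apart]]]; [by right; exists [::]|by left|].
  have [l_cover|/existsNP[x x_out]] := pselect (translates_cover l W).
    by left; exists l.
  right; exists (x :: l); rewrite /= ?szl // l_apart andbT.
  by apply/allP => y yl; apply/asboolP => Wxy; apply: x_out; exists y.
have [//|[l szl /(pairwiseP 0) l_apart]] := grow k.+1.
have [i [j [ij Wij]]] := W_index (fun i => nth 0 l i) (fun=> Logic.I).
have inl (m : 'I_k.+1) : (m : nat) \in gtn (size l) by rewrite inE szl.
by move: ij; rewrite neq_ltn => /orP[ij|ij];
  [have := l_apart _ _ (inl i) (inl j) ij|have := l_apart _ _ (inl j) (inl i) ij];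
  move=> /asboolP[] //; rewrite -opprB; exact: subgroupN.
Qed.

End Subgroups.

Lemma cover_pigeonhole (T : finType) (I : eqType) (a : seq I) (S : I -> {set T}) :
  (0 < #|T|)%N -> (forall t, exists2 y, y \in a & t \in S y) ->
  exists2 y, y \in a & (#|T| <= size a * #|S y|)%N.
Proof.
move=> T0 a_cover; apply: contrapT => all_small.
have S_small y : y \in a -> (size a * #|S y| <= #|T|.-1)%N.
  move=> ya; rewrite -ltnS prednK // ltnNge; apply/negP => S_large.
  by apply: all_small; exists y.
have a0 : (0 < size a)%N.
  by have /card_gt0P[t _] := T0; have [y] := a_cover t; case: (a).
have T_le : (#|T| <= \sum_(y <- a) #|S y|)%N.
  rewrite -sum1_card; under [leqRHS]eq_bigr do rewrite -sum1_card big_mkcond /=.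
  rewrite exchange_big; apply: leq_sum => t _ /=.
  by have [y ya ty] := a_cover t; rewrite (big_rem y) //= ty.
suff : (size a * #|T| <= size a * #|T|.-1)%N by rewrite leq_pmul2l // leqNgt ltn_predL T0.
apply: leq_trans (leq_mul (leqnn _) T_le) _; rewrite big_distrr /=.
have -> : (size a * #|T|.-1 = \sum_(y <- a) #|T|.-1)%N.
  by rewrite big_const_seq count_predT iter_addn_0 mulnC.
by rewrite big_seq [leqRHS]big_seq; apply: leq_sum => y /S_small.
Qed.

Lemma morphD0 (U V : zmodType) (f : U -> V) : {morph f : x y / x + y} -> f 0 = 0.
Proof. by move=> fD; apply: (addrI (f 0)); rewrite -fD !addr0. Qed.

Section SubgroupsExponentTwo.
Variable G : zmodType.
Hypothesis G2 : forall x : G, x + x = 0.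
Implicit Types (x y : G) (H W C : set G).

Lemma subgroup_exp2 H : H 0 -> (forall x y, H x -> H y -> H (x + y)) -> subgroup H.
Proof. by move=> H0 HD; split=> // x y; rewrite subr_exp2 //; exact: HD. Qed.

Lemma mulrn_F2D x (a b : 'F_2) : x *+ (a + b)%R = x *+ a + x *+ b.
Proof.
by rewrite -mulrnDr [in RHS](divn_eq (a + b) 2) mulrnDr mulnC mulrnA mulr2n G2 mul0rn add0r.
Qed.

Lemma span_F2_mod H (l : seq G) : subgroup H ->
  exists n (psi : 'rV['F_2]_n -> G), [/\ {morph psi : s t / s + t},
    forall t, H (psi t) -> t = 0 & forall x, x \in l -> exists t, H (x - psi t)].
Proof.
move=> sH; elim: l => [|x l [n [psi [psiD psi_inj psi_l]]]].
  by exists 0%N, (fun=> 0); split=> // t _; exact: thinmx0.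
have [[t Hxt]|x_out] := pselect (exists t, H (x - psi t)).
  by exists n, psi; split=> // y; rewrite in_cons => /predU1P[->|/psi_l//]; exists t.
pose psi' (v : 'rV['F_2]_(n + 1)) := psi (lsubmx v) + x *+ rsubmx v 0 0.
have psi'_row t (e : 'F_2) : psi' (row_mx t (const_mx e)) = psi t + x *+ e.
  by rewrite /psi' row_mxKl row_mxKr mxE.
exists (n + 1)%N, psi'; split.
- by move=> s t; rewrite /psi' !linearD psiD mxE mulrn_F2D addrACA.
- move=> v; rewrite -[v]hsubmxK [rsubmx v]mx11_scalar.
  rewrite (_ : (rsubmx v 0 0)%:M = const_mx (rsubmx v 0 0)); last first.
    by apply/rowP => i; rewrite !mxE ord1 eqxx.
  rewrite psi'_row; case: (rsubmx v 0 0) => [[|[|//]]] e_lt /= H_psi.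
    rewrite addr0 in H_psi; rewrite (psi_inj _ H_psi) -[RHS]row_mx0; congr row_mx.
    by apply/rowP => i; rewrite !mxE; apply: val_inj.
  by case: x_out; exists (lsubmx v); rewrite subr_exp2 // addrC.
- move=> y; rewrite in_cons => /predU1P[->|/psi_l[t Hyt]].
    exists (row_mx 0 (const_mx 1)); rewrite psi'_row (morphD0 psiD) add0r subrr.
    by case: sH.
  by exists (row_mx t (const_mx 0)); rewrite psi'_row addr0.
Qed.

Lemma image_perp_index n (psi : 'rV['F_2]_n -> G) (X : {set 'rV['F_2]_n}) m :
  {morph psi : s t / s + t} -> (#|X| <= m)%N ->
  cosets_met_le [set psi t | t in [set` perp X]] (range psi) (2 ^ m).
Proof.
move=> psiD X_card x x_range.
have /boolp.choice[u u_def] i : exists t, psi t = x i.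
  by have [t _ <-] := x_range i; exists t.
pose values i : {set 'rV['F_2]_n} := [set w in X | dot w (u i) == 1]%SET.
have /injectivePn[i [j ij values_ij]] : ~~ injectiveb values.
  apply/negP => /injectiveP values_inj.
  have : (#|[set values i | i in 'I_(2 ^ m).+1]%SET| <= #|powerset X|)%N.
    apply/subset_leq_card/fintype.subsetP => _ /imsetP[i _ ->].
    by rewrite powersetE; apply/fintype.subsetP => w; rewrite inE => /andP[].
  by rewrite card_imset // card_ord card_powerset leqNgt ltnS leq_exp2l ?X_card.
exists i, j; split=> //; exists (u i + u j); last by rewrite psiD !u_def subr_exp2.
apply/perpP => w wX; rewrite dotDr.
have /setP/(_ w) := values_ij; rewrite !inE wX /=.
by case: (dot w (u i)) (dot w (u j)) => [[|[|//]] ?] [[|[|//]] ?] //= _; apply: val_inj.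
Qed.

Lemma bogolyubov_seq C (a l : seq G) : translates_cover a C ->
  exists W, [/\ subgroup W, W `<=` sumset4 C &
    cosets_met_le W [set` l] (2 ^ (2 * size a ^ 2))].
Proof.
move=> a_cover.
have [n [psi [psiD psi_inj psi_l]]] := span_F2_mod l (@subgroup_set0 G).
pose S y : {set 'rV['F_2]_n} := [set t | `[< C (psi t - y) >]]%SET.
have [|y ya S_large] := cover_pigeonhole (a := a) (S := S) (card_F2_gt0 n).
  by move=> t; have [y ya Cty] := a_cover (psi t); exists y; rewrite ?inE //; exact/asboolP.
have [X X_card X_sub] := bogolyubov S_large.
exists [set psi t | t in [set` perp X]]; split.
- apply: subgroup_exp2; first by exists 0; [exact: mem0_perp|exact: morphD0].
  move=> _ _ [s /= sX <-] [t /= tX <-]; exists (s + t); last exact: psiD.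
  exact: perpD.
- move=> _ [t /X_sub[_ [t1 S1 [t2 S2 <-]] [_ [t3 S3 [t4 S4 <-]] <-]] <-].
  have inC s : [set` S y] s -> C (psi s - y) by rewrite /= inE => /asboolP.
  exists (psi t1 - y + (psi t2 - y)).
    by exists (psi t1 - y); [exact: inC|exists (psi t2 - y); [exact: inC|]].
  exists (psi t3 - y + (psi t4 - y)).
    by exists (psi t3 - y); [exact: inC|exists (psi t4 - y); [exact: inC|]].
  by rewrite !psiD ![psi _ - y + _]addrACA -opprD G2 oppr0 !addr0.
move=> x x_l; apply: (image_perp_index psiD X_card) => i.
have [t xt] := psi_l _ (x_l i); exists t => //.
by apply/esym/eqP; rewrite -subr_eq0; exact/eqP.
Qed.

Lemma bogolyubov_cover C (a : seq G) : translates_cover a C ->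
  exists W, [/\ subgroup W, W `<=` sumset4 C & exists l, translates_cover l W].
Proof.
move=> /bogolyubov_seq W_seq.
have [W [sW WC W_index]] := subgroup_limit W_seq.
by exists W; split=> //; exact: cosets_met_le_finite sW W_index.
Qed.

End SubgroupsExponentTwo.

(** * Open subgroups *)

Section TopologicalGroup.
Variable G : topologicalZmodType.
Implicit Types (x y : G) (C H K O U W : set G).

Lemma continuous_pair_comp (f : G * G -> G) (g h : G -> G) :
  continuous f -> continuous g -> continuous h -> continuous (fun z => f (g z, h z)).
Proof.
move=> fc gc hc z; apply: (@continuous_comp _ _ _ (fun z => (g z, h z))); last exact: fc.
by apply: cvg_pair; [exact: gc|exact: hc].
Qed.

Lemma continuous_subr y : continuous (fun z : G => z - y).
Proof.
apply: (continuous_pair_comp (@sub_continuous G)) => z; [exact: cvg_id|exact: cvg_cst].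
Qed.

Lemma continuous_subl y : continuous (fun z : G => y - z).
Proof.
apply: (continuous_pair_comp (@sub_continuous G)) => z; [exact: cvg_cst|exact: cvg_id].
Qed.

Lemma open_translate C y : open C -> open [set z | C (z - y)].
Proof. by move=> oC; apply: open_comp => // z _; exact: continuous_subr. Qed.

Lemma closed_translate C y : closed C -> closed [set z | C (z - y)].
Proof. by move=> cC; apply: closed_comp => // z _; exact: continuous_subr. Qed.

Lemma nbhs0_sumset U : nbhs 0 U -> exists2 V : set G, nbhs 0 V & sumset V V `<=` U.
Proof.
move=> U0; have := @add_continuous G (0, 0) U.
rewrite /= addr0 => /(_ U0)[[A B] /= [A0 B0] AB_U].
exists (A `&` B) => [|_ [x [Ax _] [y [_ By] <-]]]; first exact: filterI.
exact: (AB_U (x, y)).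
Qed.

Lemma closure_sub_sumset W C : nbhs 0 C -> closure W `<=` sumset W C.
Proof.
move=> C0 x Wx; have [|w [Ww Cw]] := Wx [set w | C (x - w)].
  by apply: continuous_subl; rewrite subrr.
by exists w => //; exists (x - w) => //; rewrite addrC subrK.
Qed.

Lemma closure_subgroup W : subgroup W -> subgroup (closure W).
Proof.
move=> [W0 WB]; split=> [|x y Wx Wy B Bxy]; first exact: subset_closure.
have [[A1 A2] /= [A1x A2y] A_B] := @sub_continuous G (x, y) B Bxy.
have [u [Wu Au]] := Wx _ A1x; have [v [Wv Av]] := Wy _ A2y.
by exists (u - v); split; [exact: WB|exact: (A_B (u, v))].
Qed.

(* The complement of [H] is a finite union of translates of [H]. *)
Lemma closed_subgroup_open H (a : seq G) :
  subgroup H -> closed H -> translates_cover a H -> open H.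
Proof.
move=> sH H_closed a_cover; have [_ HB] := sH.
pose F := \big[setU/set0]_(y <- a | ~~ `[< H y >]) [set z | H (z - y)].
have F_closed : closed F.
  by rewrite /F -big_filter; apply: closed_bigsetU => y _; exact: closed_translate.
rewrite (_ : H = ~` F); first exact: closed_openC.
apply/seteqP; split=> z; rewrite /F -bigcup_seq_cond.
  move=> Hz [y /andP[_ /asboolPn Hy] Hzy]; apply: Hy.
  by rewrite -[y](subKr z); exact: HB.
move=> zF; have [y ya Hzy] := a_cover z; apply: contrapT => Hz; apply: zF.
exists y => //=; rewrite ya /=; apply/asboolPn => Hy.
by apply: Hz; rewrite -(subrK y z); exact: subgroupD.
Qed.

Lemma compact_translates_cover C :
  compact [set: G] -> nbhs 0 C -> exists a, translates_cover a C.
Proof.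
move=> G_compact C0.
(* [cover_compact] requires a pointed type. *)
have : @cover_compact (Gp G) setT by rewrite -compact_cover.
move=> /(_ G setT (fun y => [set z | interior C (z - y)]))[y _|x _|D _ D_cover].
- by apply: open_translate; exact: open_interior.
- by exists x => //=; rewrite subrr.
exists (finmap.enum_fset D) => x; have [y yD Cxy] := D_cover x Logic.I.
by exists y => //; exact: interior_subset.
Qed.

Lemma compact_sumset_nbhs0 K O : compact K -> open O -> K `<=` O ->
  exists2 U : set G, nbhs 0 U & sumset K U `<=` O.
Proof.
move=> /compact_near_coveringP K_compact O_open KO.
have near_O x : K x -> \forall x' \near x & u \near 0, O (x' + u).
  move=> Kx; apply: (@add_continuous G (x, 0)); rewrite /= addr0.
  by apply: open_nbhs_nbhs; split=> //; exact: KO.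
exists [set u | K `<=` [set x | O (x + u)]]; first exact: K_compact near_O.
by move=> _ [x Kx [u KuO <-]]; exact: KuO.
Qed.

End TopologicalGroup.

Definition finite_quotient (G : topologicalZmodType) n (pi : G -> 'rV['F_2]_n) : Prop :=
  [/\ {morph pi : x y / x + y}, forall t, exists x, pi x = t & open [set x | pi x = 0]].

Section CompactExponentTwo.
Variable G : topologicalZmodType.
Hypotheses (G2 : forall x : G, x + x = 0) (G_compact : compact [set: G]).

Lemma open_subgroup (U : set G) : nbhs 0 U ->
  exists H : set G, [/\ subgroup H, open H & H `<=` U].
Proof.
move=> /nbhs0_sumset[V V0 VU]; have [V' V'0 V'V] := nbhs0_sumset V0.
have [C C0 CV'] := nbhs0_sumset V'0.
have [a a_cover] := compact_translates_cover G_compact C0.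
have [W [sW W_sub [l l_cover]]] := bogolyubov_cover G2 a_cover.
have clW := closure_subgroup sW; exists (closure W); split=> //.
  apply: (closed_subgroup_open (a := l) clW (@closed_closure _ W)) => x.
  by have [y yl Wxy] := l_cover x; exists y => //; exact: subset_closure.
apply: subset_trans (closure_sub_sumset V0) (subset_trans _ VU).
apply: sumsetS => //; apply: subset_trans W_sub (subset_trans _ V'V).
exact: sumsetS.
Qed.

Lemma open_subgroup_quotient (H : set G) : subgroup H -> open H ->
  exists n (pi : G -> 'rV['F_2]_n), finite_quotient pi /\ [set x | pi x = 0] = H.
Proof.
move=> sH H_open; have [H0 HB] := sH.
have [l l_cover] := compact_translates_cover G_compact (open_nbhs_nbhs (conj H_open H0)).
have [n [psi [psiD psi_inj psi_l]]] := span_F2_mod G2 l sH.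
have /boolp.choice[pi piP] x : exists t, H (x - psi t).
  have [y yl Hxy] := l_cover x; have [t Hyt] := psi_l _ yl; exists t.
  by have := subgroupD sH Hxy Hyt; rewrite subrKA.
have pi_uniq x t : H (x - psi t) -> pi x = t.
  move=> Hxt; apply/eqP; rewrite -subr_eq0 (subr_exp2 addxx_F2); apply/eqP/psi_inj.
  by have := HB _ _ (piP x) Hxt; rewrite psiD !subr_exp2 // [x + _]addrC addrKA_exp2.
have kerE : [set x | pi x = 0] = H.
  apply/seteqP; split=> x /= => [pix|Hx].
    by have := piP x; rewrite pix morphD0 // subr0.
  by apply: pi_uniq; rewrite morphD0 // subr0.
exists n, pi; split; last exact: kerE.
split; last by rewrite kerE.
- by move=> x y; apply: pi_uniq; rewrite psiD opprD addrACA; exact: subgroupD.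
- by move=> t; exists (psi t); apply: pi_uniq; rewrite subrr.
Qed.

Lemma separating_quotient (K O : set G) : compact K -> open O -> K `<=` O ->
  exists n (pi : G -> 'rV['F_2]_n),
    finite_quotient pi /\ forall x y, K x -> pi x = pi y -> O y.
Proof.
move=> K_compact O_open /(compact_sumset_nbhs0 K_compact O_open)[U U0 KU_O].
have [H [sH H_open HU]] := open_subgroup U0.
have [n [pi [pi_quotient kerE]]] := open_subgroup_quotient sH H_open.
exists n, pi; split=> // x y Kx pixy; have [piD _ _] := pi_quotient.
apply: KU_O; exists x => //; exists (x + y); last exact: addKr_exp2.
by apply: HU; rewrite -kerE /= piD pixy addxx_F2.
Qed.

End CompactExponentTwo.

(** * Haar measure and finite quotients *)

Lemma fsbig_finType (R : Type) (idx : R) (op : Monoid.com_law idx) (I : finType)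
    (F : I -> R) :
  \big[op/idx]_(i \in [set: I]) F i = \big[op/idx]_i F i.
Proof.
have -> : [set: I] = [set` enum I] by apply/seteqP; split=> i //= _; rewrite mem_enum.
by rewrite -fsbig_seq ?enum_uniq // big_enum.
Qed.

Section Haar.
Variables (R : realType) (G : topologicalZmodType).
Variable mu : {measure set (borel G) -> \bar R}.
Hypothesis hmu : haar_probability mu.
Implicit Types B C : set (borel G).

Definition haar B : R := fine (mu B).

Lemma open_measurable_borel (O : set G) : open O -> measurable (O : set (borel G)).
Proof. by move=> O_open; exact: sub_sigma_algebra. Qed.

Lemma haar_fin_num B : measurable B -> mu B \is a fin_num.
Proof.
case: hmu => mu1 _ _ mB; rewrite ge0_fin_numE //.
by apply: le_lt_trans (ltry 1); rewrite -mu1; apply: le_measure; rewrite ?inE.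
Qed.

Lemma haarE B : measurable B -> mu B = (haar B)%:E.
Proof. by move=> mB; rewrite /haar fineK // haar_fin_num. Qed.

Lemma haar_ge0 B : 0 <= haar B.
Proof. exact: fine_ge0. Qed.

Lemma haar_setT : haar setT = 1.
Proof. by case: hmu => mu1 _ _; rewrite /haar mu1. Qed.

Lemma haarU B C : measurable B -> measurable C -> B `&` C = set0 ->
  haar (B `|` C) = haar B + haar C.
Proof.
move=> mB mC BC; apply: EFin_inj; rewrite EFinD -!haarE //; last exact: measurableU.
exact: measureU.
Qed.

Lemma haarD B C : measurable B -> measurable C -> B `<=` C ->
  haar (C `\` B) = haar C - haar B.
Proof.
move=> mB mC BC; rewrite -[in RHS](setDUK BC) haarU ?setDIK //.
  by rewrite addrAC subrr add0r.
exact: measurableD.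
Qed.

Lemma haar_compact_approx B (e : R) : hausdorff_space G -> measurable B -> 0 < e ->
  exists K : set G, [/\ compact K, measurable (K : set (borel G)), K `<=` B &
    haar B - haar K <= e].
Proof.
move=> G_hausdorff mB e0; have [_ _ reg] := hmu.
have := haar_fin_num mB; rewrite (reg B mB) => sup_fin.
have [_ [K [K_compact KB] <-] K_gt] := ub_ereal_sup_adherent e0 sup_fin.
have mK : measurable (K : set (borel G)).
  rewrite -[K]setCK; apply: measurableC; apply: open_measurable_borel.
  by apply: closed_openC; exact: compact_closed.
exists K; split=> //.
by move: K_gt; rewrite -(reg B mB) (haarE mB) (haarE mK) -EFinB lte_fin => /ltW; lra.
Qed.

Lemma integrable_indic_haar B : measurable B -> mu.-integrable setT (fun x => (\1_B x)%:E).
Proof.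
move=> mB; apply/integrableP; split.
  by apply/measurable_EFinP; exact: measurable_indic.
under eq_integral do rewrite gee0_abs ?lee_fin //.
by rewrite integral_indic // setIT -ge0_fin_numE // haar_fin_num.
Qed.

End Haar.

Section FiniteQuotient.
Variables (R : realType) (G : topologicalZmodType).
Variable mu : {measure set (borel G) -> \bar R}.
Hypothesis hmu : haar_probability mu.
Local Notation haar := (haar mu).

Variables (n : nat) (pi : G -> 'rV['F_2]_n).
Hypothesis pi_quotient : finite_quotient pi.
Local Notation T := 'rV['F_2]_n.
Implicit Types (t w : T) (V : {vspace T}) (B : set (borel G)).

Let piD : {morph pi : x y / x + y}.
Proof. by case: pi_quotient. Qed.

Let pi_surj t : exists x, pi x = t.
Proof. by case: pi_quotient. Qed.

Let N_gt0 : 0 < #|{: T}|%:R :> R.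
Proof. by rewrite ltr0n card_F2_gt0. Qed.

Definition fiber t : set (borel G) := pi @^-1` [set t].

Lemma fiber_translate x : fiber (pi x) = [set x + y | y in fiber 0].
Proof.
apply/seteqP; split=> [z /= pizx|_ [y /= y0 <-]]; last by rewrite /fiber /= piD y0 addr0.
exists (z - x); last by rewrite addrC subrK.
by apply: (addIr (pi x)); rewrite -piD subrK add0r.
Qed.

Lemma open_fiber t : open (fiber t : set G).
Proof.
have [x <-] := pi_surj t.
rewrite (_ : fiber (pi x) = [set z | [set y | pi y = 0] (z - x)]).
  by apply: open_translate; case: pi_quotient.
apply/seteqP; split=> z /= => [|zx0]; rewrite /fiber /=.
  by move=> pizx; apply: (addIr (pi x)); rewrite -piD subrK add0r.
by rewrite -[z](subrK x) piD zx0 add0r.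
Qed.

Lemma measurable_fiber t : measurable (fiber t).
Proof. by apply: open_measurable_borel; exact: open_fiber. Qed.

Lemma measurableI_fiber B t : measurable B -> measurable (B `&` fiber t).
Proof. by move=> mB; apply: measurableI => //; exact: measurable_fiber. Qed.

Lemma haar_sum_fiber B : measurable B -> haar B = \sum_t haar (B `&` fiber t).
Proof.
move=> mB; apply: EFin_inj; rewrite -sumEFin -(haarE hmu) //.
under eq_bigr do rewrite -(haarE hmu (measurableI_fiber _ mB)).
have B_cover : B = \bigcup_(t in [set: T]) (B `&` fiber t).
  by apply/seteqP; split=> [x Bx|x [t _ []] //]; exists (pi x).
rewrite [in LHS]B_cover measure_fin_bigcup; first exact: fsbig_finType.
- exact: finite_finset.
- by move=> s t _ _ [x [[_ <-] [_ <-]]].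
- by move=> t _; exact: measurableI_fiber.
Qed.

Lemma haar_fiber t : haar (fiber t) = #|{: T}|%:R^-1.
Proof.
have eq_haar u : haar (fiber u) = haar (fiber 0).
  have [x <-] := pi_surj u; case: hmu => _ invariant _.
  by rewrite [LHS]/(fine _) fiber_translate invariant //; exact: measurable_fiber.
have := haar_sum_fiber measurableT; rewrite haar_setT //.
under eq_bigr do rewrite setTI eq_haar.
rewrite sumr_const -[_ *+ _]mulr_natl eq_haar => haar_eq.
by apply: (mulfI (lt0r_neq0 N_gt0)); rewrite -haar_eq mulfV ?lt0r_neq0.
Qed.

Definition density B t : R := #|{: T}|%:R * haar (B `&` fiber t).

Lemma density_ge0 B t : 0 <= density B t.
Proof. by rewrite mulr_ge0 ?haar_ge0. Qed.

Lemma density_setC B t : measurable B -> density (~` B) t = 1 - density B t.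
Proof.
move=> mB; apply/eqP; rewrite eq_sym subr_eq; apply/eqP.
rewrite /density -mulrDr -haarU //.
- by rewrite -setIUl setUC setUv setTI haar_fiber mulfV ?lt0r_neq0.
- by apply: measurableI_fiber; exact: measurableC.
- exact: measurableI_fiber.
- by rewrite setIACA setICl set0I.
Qed.

Lemma density_itv B t : measurable B -> 0 <= density B t <= 1.
Proof.
by move=> mB; rewrite density_ge0 -subr_ge0 -density_setC // density_ge0.
Qed.

Lemma mean_density B : measurable B -> mean (density B) = haar B.
Proof.
by move=> mB; rewrite /mean -big_distrr /= mulKf ?lt0r_neq0 // -haar_sum_fiber.
Qed.

Lemma bernoulli_var_density_le B (K K' : set (borel G)) :
  measurable B -> measurable K -> measurable K' -> K `<=` B -> K' `<=` ~` B ->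
  (forall x y, K x -> K' y -> pi x <> pi y) ->
  bernoulli_var (density B) <= (haar B - haar K) + (haar (~` B) - haar K').
Proof.
move=> mB mK mK' KB K'B sep; have mBC := measurableC mB.
have mD := measurableD mB mK; have mD' := measurableD mBC mK'.
rewrite -!(haarD hmu) // (haar_sum_fiber mD) (haar_sum_fiber mD') -big_split /=.
rewrite /bernoulli_var /mean big_distrr; apply: ler_sum => t _ /=.
rewrite -density_setC // ler_pdivrMl // mulrDr.
have /andP[d0 d1] := density_itv t mB; have /andP[d0' d1'] := density_itv t mBC.
have [[x [Kx xt]]|K_empty] := pselect (exists x, K x /\ pi x = t).
  have -> : (~` B `\` K') `&` fiber t = ~` B `&` fiber t.
    apply/seteqP; split=> y [By yt]; split=> //; first by case: By.
    by split=> // K'y; apply: (sep x y) => //; rewrite xt yt.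
  rewrite ler_wpDl ?mulr_ge0 ?haar_ge0 //; exact: ler_piMl.
have -> : (B `\` K) `&` fiber t = B `&` fiber t.
  apply/seteqP; split=> y [By yt]; split=> //; first by case: By.
  by split=> // Ky; apply: K_empty; exists y.
rewrite ler_wpDr ?mulr_ge0 ?haar_ge0 //; exact: ler_piMr.
Qed.

Variable A : set (borel G).
Hypothesis mA : measurable A.

Lemma Rintegral_indic_fibers (c : T -> R) :
  Rintegral mu setT (fun x => \1_A x * c (pi x)) = mean (fun t => density A t * c t).
Proof.
have mAt t := measurableI_fiber t mA.
have -> : mean (fun t => density A t * c t) = \sum_t c t * haar (A `&` fiber t).
  rewrite /mean big_distrr; apply: eq_bigr => t _ /=.
  by rewrite /density -mulrA mulKf ?lt0r_neq0 // mulrC.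
rewrite /Rintegral
  (eq_integral (fun x => \sum_t ((c t)%:E * (\1_(A `&` fiber t) x)%:E))%E) => [|x _].
  rewrite integral_sum // => [|t]; last first.
    by apply: integrableZl => //; exact: integrable_indic_haar.
  rewrite (eq_bigr (fun t => (c t * haar (A `&` fiber t))%:E)) ?sumEFin // => t _.
  rewrite integralZl //; last exact: integrable_indic_haar.
  by rewrite integral_indic // setIT (haarE hmu).
under eq_bigr do rewrite -EFinM; rewrite sumEFin; congr (_%:E).
rewrite (bigD1 (pi x)) //= big1 => [|t tx].
  by rewrite addr0 mulrC !indicE in_setI (mem_set (erefl : fiber (pi x) x)) andbT.
rewrite indicE in_setI [x \in fiber t]memNset ?andbF ?mulr0 // => pixt.
by rewrite -pixt eqxx in tx.
Qed.

Definition quotient_char w : G -> R[i] := fun x => ((chi R w (pi x))%:C)%C.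

Lemma quotient_char_dual w : @dual R G (quotient_char w).
Proof.
split=> [x C /nbhs_singleton Cx|x|x y].
- apply: (@filterS _ _ _ (fiber (pi x))) => [z|]; last first.
    by apply: open_nbhs_nbhs; split; [exact: open_fiber|].
  by rewrite /fiber /= => zx; rewrite /quotient_char zx.
- by rewrite normc_def /= expr0n addr0 sqrtr_sqr normr_chi.
- by rewrite /quotient_char piD chiDr rmorphM.
Qed.

Lemma quotient_char_inj : injective quotient_char.
Proof.
move=> w v wv; apply: (@chi_inj R n); apply/funext => t; have [x <-] := pi_surj t.
by have /(congr1 (@complex.Re R)) := congr1 (fun g => g x) wv.
Qed.

Lemma normc_fourier_quotient_char w :
  ComplexField.Normc.normc (fourier mu (cindic R A) (quotient_char w)) =
    `|hat (density A) w|.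
Proof.
rewrite /fourier /cintegral /hat -Rintegral_indic_fibers.
have -> : (fun x => complex.Re (cindic R A x * (quotient_char w x)^*)) =
    (fun x => \1_A x * chi R w (pi x)) by apply/funext => x /=; ring.
have -> : (fun x => complex.Im (cindic R A x * (quotient_char w x)^*)) = fun=> 0.
  by apply/funext => x /=; ring.
have -> : Rintegral mu setT (fun=> 0) = 0 by rewrite /Rintegral integral0.
by rewrite rmorph0 mulr0 addr0 /= expr0n /= addr0 sqrtr_sqr.
Qed.

Lemma sum_norm_hat_density_le_Anorm :
  ((\sum_w `|hat (density A) w|)%:E <= Anorm mu (cindic R A))%E.
Proof.
apply: esum_ge; exists (range quotient_char).
  by split; [exact: finite_image|move=> _ [w _ <-]; exact: quotient_char_dual].
rewrite fsbig_image; last by move=> w v _ _; exact: quotient_char_inj.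
rewrite fsbig_finType -sumEFin; apply: lee_sum => w _.
by rewrite normc_fourier_quotient_char.
Qed.

Lemma card_quotient_char V : card_set (quotient_char @` [set` V]) = #|V|.
Proof.
rewrite cardE -(size_map quotient_char); apply/perm_size/uniq_perm.
- exact: finmap.fset_uniq.
- by rewrite map_inj_uniq ?enum_uniq //; exact: quotient_char_inj.
have V_finite : finite_set (quotient_char @` [set` V]) by exact: finite_image.
move=> g; rewrite [LHS](in_fset_set V_finite); apply/idP/mapP => [|[w]].
  by rewrite inE => -[w /= wV <-]; exists w; rewrite ?mem_enum.
by rewrite mem_enum => wV ->; rewrite inE; exists w.
Qed.

Lemma finite_subgroup_quotient_char V :
  finite_subgroup_dual (quotient_char @` [set` V]).
Proof.
split.
- exact: finite_image.
- by move=> _ [w _ <-]; exact: quotient_char_dual.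
- by exists 0; [exact: mem0v|apply/funext => x; rewrite /quotient_char chi0l].
- move=> _ _ [w /= wV <-] [v /= vV <-]; exists (w + v); first exact: memvD.
  by apply/funext => x; rewrite /quotient_char chiDl rmorphM.
- move=> _ [w /= wV <-]; exists w => //; apply/funext => x.
  by rewrite /quotient_char /chi rmorphXn /= rmorphN1 invr_sign.
Qed.

End FiniteQuotient.

Lemma finite_model (R : realType) (G : topologicalZmodType)
    (mu : {measure set (borel G) -> \bar R}) (A : set (borel G)) (e : R) :
  compact_F2_space G -> haar_probability mu -> measurable A -> 0 < e ->
  exists n (pi : G -> 'rV['F_2]_n),
    finite_quotient pi /\ bernoulli_var (density mu pi A) <= e.
Proof.
move=> [G_compact G_hausdorff G2] hmu mA e0.
have e2 : 0 < e / 2 by rewrite divr_gt0.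
have mAC := measurableC mA.
have [K [K_compact mK KA K_approx]] := haar_compact_approx hmu G_hausdorff mA e2.
have [K' [K'_compact mK' K'A K'_approx]] := haar_compact_approx hmu G_hausdorff mAC e2.
have K'C_open : open (~` K') by apply: closed_openC; exact: compact_closed.
have [|n [pi [pi_quotient sep]]] :=
    separating_quotient G2 G_compact K_compact K'C_open.
  by move=> x /KA Ax /K'A.
exists n, pi; split=> //.
have := bernoulli_var_density_le hmu pi_quotient mA mK mK' KA K'A.
move=> /(_ _)/le_trans; apply; last by lra.
by move=> x y Kx K'y pixy; exact: sep Kx pixy K'y.
Qed.

Theorem theorem2p4 (R : realType) (delta : R) (hdelta : 0 < delta) :
  exists c : R, 0 < c /\
  forall (G : topologicalZmodType) (mu : {measure set (borel G) -> \bar R})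
         (M : R) (A : set (borel G)),
    compact_F2_space G -> haar_probability mu -> 16 <= M -> measurable A ->
    (forall V : set (G -> R[i]), finite_subgroup_dual V ->
       (card_set V)%:R <= M ->
       delta <= fracpart (fine (mu A) * (card_set V)%:R)
                * (1 - fracpart (fine (mu A) * (card_set V)%:R))) ->
    ((c * ln (ln M))%:E <= Anorm mu (cindic R A))%E.
Proof.
exists (loglog_const delta); split; first exact: loglog_const_gt0.
move=> G mu M A hG hmu hM mA gap.
have M1 : 1 < M by lra.
have e0 : 0 < delta / (2 * M) by rewrite divr_gt0 // mulr_gt0 //; lra.
have [n [pi [pi_quotient var_le]]] := finite_model hG hmu mA e0.
apply: le_trans (sum_norm_hat_density_le_Anorm hmu pi_quotient mA).
rewrite lee_fin; apply: ler_sum_norm_hat_loglog var_le _ => // [t|V].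
  exact: (density_itv hmu).
have := gap _ (finite_subgroup_quotient_char R pi_quotient V).
by rewrite card_quotient_char // (mean_density hmu pi_quotient mA).
Qed.
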